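(* Let $l\geq 3$ and let $a_1,a_2,\ldots,a_l\geq 1$ be integers. Then $$\tau_{\mathrm{max}}(a_1,a_2,\ldots,a_l)=\Big\langle \prod_{i=1}^l p_{a_i}(t),\,t^2G_C(t)\Big\rangle_t .$$
   Context: A configuration is a finite subset $\mathcal C$ of the oriented plane $\mathbb R^2$. A triangulation of $\mathcal C$ is a finite set of (non-degenerate) Euclidean triangles with vertices in $\mathcal C$ whose union is $\mathrm{conv}(\mathcal C)$ and such that any two of them intersect in the empty set, a common vertex or a common edge; it is maximal if every point of $\mathcal C$ is a vertex of one of its triangles. A weakly convex polygon is a configuration contained in the boundary of its convex hull; its edges are the segments joining consecutive extremal points (vertices of $\mathrm{conv}(\mathcal C)$), and an edge has weight $a$ if it contains exactly $a+1$ points of $\mathcal C$. $P(a_1,\ldots,a_l)$ denotes a weakly convex polygon with $l$ edges of successive weights $a_1,\ldots,a_l$ in counterclockwise order (this determines it up to isotopy, which preserves the numbers of triangulations), and $\tau_{\mathrm{max}}(a_1,\ldots,a_l)$ is its number of maximal triangulations. The maximal edge polynomials are $p_m(t)=\sum_{k=0}^{\lfloor m/2\rfloor}(-1)^k\binom{m-k}{k}t^{m-k}$ for $m\geq 1$. $C_k=\binom{2k}{k}/(k+1)$ are the Catalan numbers and $G_C(t)=\sum_{k\geq 0}C_kt^k$. For a polynomial $p(t)=\sum_{k\geq 2}\alpha_kt^k$ one sets $\langle p(t),t^2G_C(t)\rangle_t=\sum_{k\geq 2}\alpha_kC_{k-2}$. *)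

(* Defs.v *)
From HB Require Import structures.
From mathcomp Require Import all_boot all_order all_algebra finmap.
From mathcomp Require Import boolp classical_sets reals topology normedtype.
From mathcomp Require Import convex.

Set Implicit Arguments.
Unset Strict Implicit.
Unset Printing Implicit Defensive.

Import Order.TTheory GRing.Theory Num.Theory.
Import numFieldNormedType.Exports.

Local Open Scope fset_scope.
Local Open Scope classical_set_scope.
Local Open Scope ring_scope.

Notation plane R := 'rV[R]_2.

Section PlaneGeometry.
Variable R : realType.
Implicit Types (a b c u v p : plane R) (K : set (plane R)).

(* Twice the signed area of abc: positive iff a, b, c turn counterclockwise. *)
Definition orient a b c : R :=
  (b 0 0 - a 0 0) * (c 0 1 - a 0 1) - (b 0 1 - a 0 1) * (c 0 0 - a 0 0).

Definition convex_hull K : set (plane R) := smallest (@convex_set R (plane R)) K.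

Definition segment u v : set (plane R) := convex_hull [set u; v].

Definition boundary K : set (plane R) := closure K `\` interior K.

Definition extremal_points K : set (plane R) :=
  [set p | K p /\ forall u v, K u -> K v -> segment u v p -> p = u \/ p = v].

End PlaneGeometry.

Section Triangulations.
Variable R : realType.
Implicit Types (C s t : {fset plane R}) (T : {fset {fset plane R}}).

(* The configuration C is a finite set of points, and hull C its convex hull.
   A non-degenerate triangle is encoded by the set t of its three vertices,
   which determines it; the triangle itself is then hull t. *)
Definition hull C : set (plane R) := convex_hull [set` C].

Definition nondegenerate_triangle t :=
  exists a b c, t = [fset a; b; c]%fset /\ orient a b c != 0.

Definition meet_properly s t :=
  [\/ hull s `&` hull t = set0,
      exists2 v, v \in (s `&` t)%fset & hull s `&` hull t = [set v]
    | exists u v, [/\ u \in (s `&` t)%fset, v \in (s `&` t)%fset, u != v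
                    & hull s `&` hull t = segment u v]].

Definition triangulation C T :=
  [/\ forall t, t \in T -> (t `<=` C)%fset /\ nondegenerate_triangle t,
      \bigcup_(t in [set` T]) hull t = hull C
    & forall s t, s \in T -> t \in T -> s != t -> meet_properly s t].

Definition maximal_triangulation C T :=
  triangulation C T /\ forall c, c \in C -> exists2 t, t \in T & c \in t.

(* The clause on triangles in [triangulation] makes every triangulation of C an
   element of the iterated powerset. *)
Definition tau_max C : nat :=
  #|` [fset T in fpowerset (fpowerset C) | `[< maximal_triangulation C T >]]%fset |.

Definition weakly_convex_polygon C := [set` C] `<=` boundary (hull C).

(* C is a P(a 0, ..., a (l-1)): v lists the vertices of hull C without
   repetition, and v (ordS i), the cyclic successor, is the vertex following
   v i counterclockwise, as C lies to the left of the line directed from v i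
   to v (ordS i). *)
Definition polygon_with_weights (l : nat) (a : 'I_l -> nat) C :=
  weakly_convex_polygon C /\
  exists v : 'I_l -> plane R,
    [/\ injective v,
        range v = extremal_points (hull C),
        forall i c, c \in C -> 0 <= orient (v i) (v (ordS i)) c
      & forall i, #|` [fset c in C | c \in segment (v i) (v (ordS i))]%fset |
                  = (a i).+1].

End Triangulations.

Definition max_edge_poly (m : nat) : {poly int} :=
  \sum_(k < m./2.+1) ((-1) ^+ k * 'C(m - k, k)%:R) *: 'X^(m - k).

(* The division is exact. *)
Definition catalan (k : nat) : nat := 'C(k.*2, k) %/ k.+1.

(* <p(t), t^2 G_C(t)>_t, where G_C is the generating series of the Catalan
   numbers; meant for p divisible by 'X^2. *)
Definition catalan_pairing (p : {poly int}) : int :=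
  \sum_(2 <= k < size p) p`_k * (catalan (k - 2))%:R.

(* Main.v *)
Require Import Defs.
From mathcomp Require Import all_boot all_order all_algebra finmap.
From mathcomp Require Import boolp classical_sets reals topology normedtype.
From mathcomp Require Import interval_inference convex ring lra zify.

(* Number the points q_0, ..., q_n of C counterclockwise, q_0 being a vertex.
   In a maximal triangulation no triangle contains a point of C other than its
   vertices, hence exactly one triangle has the base q_0 q_n as an edge; if q_k
   is its apex, every other triangle lies in the chain q_0 ... q_k or in the
   chain q_k ... q_n. The numbers N(i, j) of maximal triangulations of the
   chains q_i ... q_j therefore satisfy the Catalan-like recursion
     N(i, j) = \sum_(i < k < j) N(i, k) N(k, j),
   where k ranges over the points that are not collinear with q_i and q_j; so
   N(i, j) = 0 for a flat chain with an interior point.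

   On the algebraic side let L(t^k) = C_(k-1) and, for a chain that meets the
   edges of C in b_1, ..., b_r steps, Q = \prod p_(b_s). With
   Delta(t^k) = \sum_(x + y = k; x, y >= 1) u^x v^y the Catalan recurrence reads
   L(p) = (L (x) L)(Delta p) + [t] p, and p_(m+2) = t (p_(m+1) - p_m) implies
   that Delta Q is the sum of Q' (u) Q'' (v) over all splittings of the chain
   into two nonempty chains. Thus L(Q) satisfies the same recursion as N. *)

Set Implicit Arguments.
Unset Strict Implicit.
Unset Printing Implicit Defensive.

Import Order.TTheory GRing.Theory Num.Theory.
Import numFieldNormedType.Exports.

Local Open Scope ring_scope.

(** * Catalan numbers and edge polynomials *)

Section Catalan.

(** The closed polygon is the delicate case. Its base from [q_n] to [q_0] is a piece of the last
    edge, so further points of that edge are collinear with the base but lie outside it: the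
    admissible apexes are only the points off the last edge. On the algebraic side the n+1 sides
    give the product [Q 0 n.+1]. Removing the base side by the recurrence of the edge polynomials
    leaves L(Q 0 n) minus, if the last edge has weight at least 2, L(Q 0 n.-1). The subtracted term
    is exactly what the inadmissible apexes contribute to the recursion for L(Q 0 n), because flat
    chains of several steps contribute 0.

    For the recursion to be local, triangulations of a chain are described without reference to the
    rest of [C]. Covering is required only strictly off the base line, so that a single step has the
    empty triangulation. Maximality becomes two conditions: every inner point is used, and a
    triangle contains no points of the chain except its vertices. *)

Lemma catalanE k : (catalan k * k.+1 = 'C(k.*2, k))%N.
Proof.
rewrite /catalan divnK //; apply/dvdnP; exists ('C(k.*2, k) - 'C(k.*2, k.+1))%N.
by have := mul_bin_left k.*2 k; rewrite -addnn addnK; nia.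
Qed.

Lemma catalanS k : (catalan k.+1 * k.+2 = catalan k * (k.*2.+1).*2)%N.
Proof.
have /= b1 := mul_bin_diag k.*2.+2 k.
have /= b2 := mul_bin_down k.*2.+1 k.
have := catalanE k; have := catalanE k.+1; rewrite doubleS => c1 c0.
have kk : (k.*2.+1 - k = k.+1)%N by lia.
rewrite kk in b2; apply/eqP; rewrite -(eqn_pmul2l (ltn0Sn k)); nia.
Qed.

Let C k : int := (catalan k)%:R.
(** [S] is the convolution and [T] its first moment. The symmetry [i <-> n - i] gives [2 T = n S],
    and the two-term recurrence of the Catalan numbers gives a second linear relation; together they
    determine [S n.+1] from [S n]. *)
Let S n := \sum_(i < n.+1) C i * C (n - i).
Let T n := \sum_(i < n.+1) i%:R * (C i * C (n - i)).

Let CS k : (k.+2%:R * C k.+1 = (k.*2.+1).*2%:R * C k).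
Proof. by rewrite /C -!natrM mulnC catalanS mulnC. Qed.

Let TS n : 2 * T n = n%:R * S n.
Proof.
have e : T n = \sum_(i < n.+1) (n%:R - i%:R) * (C i * C (n - i)).
  rewrite /T (reindex_inj rev_ord_inj) /=; apply: eq_bigr => i _.
  by rewrite subSS subKn ?leq_ord // natrB ?leq_ord // (mulrC (C i)).
rewrite mulr2n mulrDl mul1r {2}e /T -big_split /S big_distrr /=.
by apply: eq_bigr => i _; ring.
Qed.

Lemma catalan_convolution n :
  (catalan n.+1)%:R = \sum_(i < n.+1) (catalan i)%:R * (catalan (n - i))%:R :> int.
Proof.
rewrite -/(C _); suff -> : C n.+1 = S n by [].
elim: n => [|n IH]; first by rewrite /S big_ord1 /C.
(* The left side is the sum of [(i + 1) C_i C_(n+1-i)]: its term [i = 0] is [C_(n+1)], and the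
   recurrence turns the later ones into [(4i + 2) C_i C_(n-i)]. *)
have e : T n.+1 + S n.+1 = C n.+1 + 4 * T n + 2 * S n.
  rewrite /T /S -big_split /= big_ord_recl /= subn0 /C.
  rewrite -[RHS]addrA; congr (_ + _); first by rewrite (_ : catalan 0 = 1%N) // mul0r add0r mul1r.
  rewrite !big_distrr -big_split /=; apply: eq_bigr => i _.
  rewrite /bump add1n subSS -/(C _) -/(C _) -/(C _).
  have := CS i; rewrite -!muln2 !natrM -!natr1 natrM => c.
  have -> : (i%:R + 1) * (C i.+1 * C (n - i)) + C i.+1 * C (n - i) =
    ((i%:R + 1 + 1) * C i.+1) * C (n - i).
    by move: (C _) (C _) => x y; ring.
  by rewrite c; move: (C _) (C _) => x y; ring.
have := TS n.+1; have := TS n; have := CS n.+1.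
rewrite -IH in e *; rewrite -!muln2 !natrM -!natr1 natrM => c t0 t1.
have n3 : n%:R + 3 != 0 :> int by rewrite lt0r_neq0 // ltr_wpDl.
apply: (mulfI n3); move: n3; rewrite -natr1 in c; lia.
Qed.

End Catalan.

(** * The three-term recurrence of the edge polynomials *)

Section EdgePoly.

(** ['C(m - k, k)] vanishes for [2k > m], also where [m - k] is truncated to 0. Raising the bounds
    gives the sums for [m], [m.+1] and [m.+2] matching ranges, so that the recurrence can be read
    termwise. *)
Lemma max_edge_polyE m N : (m./2 < N)%N -> max_edge_poly m =
  \sum_(k < N) ((-1) ^+ k * 'C(m - k, k)%:R) *: 'X^(m - k).
Proof.
move=> mN; rewrite /max_edge_poly.
rewrite -(big_mkord xpredT (fun k => ((-1) ^+ k * 'C(m - k, k)%:R) *: 'X^(m - k))).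
rewrite -(big_mkord xpredT (fun k => ((-1) ^+ k * 'C(m - k, k)%:R) *: 'X^(m - k))).
rewrite [RHS](big_cat_nat (n := m./2.+1)) //= -[LHS]addr0; congr (_ + _).
rewrite big_nat_cond big1 // => k.
rewrite andbT => /andP[mk _]; rewrite bin_small ?mulr0 ?scale0r //.
by move: mk; rewrite ltn_half_double; lia.
Qed.

(** The value at 0 is the factor of an edge that a chain does not meet. *)
Lemma max_edge_poly0 : max_edge_poly 0 = 1.
Proof. by rewrite /max_edge_poly big_ord1 expr0 bin0 mulr1 scale1r. Qed.

Lemma max_edge_poly1 : max_edge_poly 1 = 'X.
Proof. by rewrite /max_edge_poly big_ord1 expr0 bin0 mulr1 scale1r. Qed.

(** Pascal's rule for ['C(m.+2 - k, k)], after splitting off the leading term [k = 0]. *)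
Lemma max_edge_polySS m :
  max_edge_poly m.+2 = 'X * (max_edge_poly m.+1 - max_edge_poly m).
Proof.
rewrite (@max_edge_polyE m.+2 m.+2) ?(@max_edge_polyE m.+1 m.+2)
  ?(@max_edge_polyE m m.+1); try by rewrite ltn_half_double -addnn; lia.
rewrite [LHS]big_ord_recl [X in 'X * (X - _)]big_ord_recl mulrBr mulrDr -addrA; congr (_ + _).
  by rewrite !subn0 !bin0 !expr0 !mulr1 !scale1r exprS.
rewrite !big_distrr /= -sumrB; apply: eq_bigr => k _.
have km : (k <= m)%N by rewrite -ltnS.
rewrite /bump add1n !subSS subSn // binS natrD !mulrDr scalerDl.
rewrite -!scalerAr -exprS exprS; congr (_ + _).
by rewrite mulN1r mulNr scaleNr.
Qed.

End EdgePoly.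

(** * Linear forms on polynomials and the Catalan splitting *)

Section Functionals.
Implicit Types (p q : {poly int}) (u v : nat -> int).

Definition functional (u : nat -> int) (p : {poly int}) : int := \sum_(k < size p) p`_k * u k.

Lemma functional_wide u p n : (size p <= n)%N -> functional u p = \sum_(k < n) p`_k * u k.
Proof.
move=> pn; rewrite /functional -!(big_mkord xpredT (fun k => p`_k * u k)).
rewrite [RHS](big_cat_nat (n := size p)) //= -[LHS]addr0; congr (_ + _).
rewrite big_nat_cond big1 // => k.
by rewrite andbT => /andP[pk _]; rewrite nth_default // mul0r.
Qed.

Lemma functionalB u p q : functional u (p - q) = functional u p - functional u q.
Proof.
pose n := maxn (size p) (size q).
rewrite !(@functional_wide u _ n) ?leq_maxl ?leq_maxr //; last first.
  by rewrite (leq_trans (size_polyD _ _)) // size_polyN.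
by rewrite -sumrB; apply: eq_bigr => k _; rewrite coefB mulrBl.
Qed.

Lemma functional0 u : functional u 0 = 0.
Proof. by rewrite -(subrr 0) functionalB subrr. Qed.

Lemma functionalMn u p (b : bool) : functional u (p *+ b) = functional u p *+ b.
Proof. by case: b; rewrite ?mulr0n ?functional0. Qed.

Lemma functional1 u : functional u 1 = u 0%N.
Proof. by rewrite /functional size_poly1 big_ord1 coef1 mul1r. Qed.

Lemma functionalMX u p : functional u ('X * p) = functional (fun k => u k.+1) p.
Proof.
rewrite (@functional_wide _ _ (size p).+1); last first.
  by rewrite mulrC (leq_trans (size_polyMleq _ _)) // size_polyX addn2.
rewrite big_ord_recl coefXM mul0r add0r; apply: eq_bigr => k _.
by rewrite lift0 coefXM.
Qed.

Lemma eq_functional u v p : u =1 v -> functional u p = functional v p.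
Proof. by move=> uv; apply: eq_bigr => k _; rewrite uv. Qed.

Lemma functional_add u v p : functional (fun k => u k + v k) p = functional u p + functional v p.
Proof. by rewrite /functional -big_split; apply: eq_bigr => k _; rewrite mulrDr. Qed.

Lemma functional_mulr u x p : functional (fun k => u k * x) p = functional u p * x.
Proof. by rewrite /functional big_distrl; apply: eq_bigr => k _; rewrite mulrA. Qed.

Lemma functional_coef m p : functional (fun k => (k == m)%:R) p = p`_m.
Proof.
rewrite (@functional_wide _ _ (maxn (size p) m.+1)) ?leq_maxl //.
have mN : (m < maxn (size p) m.+1)%N by rewrite leq_maxr.
rewrite (bigD1 (Ordinal mN)) //= eqxx mulr1 big1 ?addr0 // => k km.
by rewrite -val_eqE /= in km; rewrite (negbTE km) mulr0.
Qed.

(* [path_catalan k] counts the triangulations of the convex (k+1)-gon, seen as a path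
   of k edges closed by a base edge. *)
Definition path_catalan k : int := if k is k'.+1 then (catalan k')%:R else 0.

(** This is L(t^n p) for the form L of the overview. The shift [n] is a separate parameter so that
    inductions can move a factor ['X] into it. *)
Definition path_count n := functional (fun k => path_catalan (n + k)).

(* Splits off a first part of a path in all possible ways, leaving a second part
   to which [n] steps are appended. *)
Definition split_count n :=
  functional (fun a => \sum_(x < a) path_catalan x.+1 * path_catalan (n + (a - x.+1))).

Lemma path_countMX n p : path_count n ('X * p) = path_count n.+1 p.
Proof. by rewrite /path_count functionalMX; apply: eq_functional => k; rewrite addnS. Qed.

(** Applied to [t^(a+1)], the extra splitting is the one whose first part takes all [a + 1] steps;
    in the others the new step joins the appended ones. *)
Lemma split_countMX n p : split_count n ('X * p) =
  split_count n.+1 p + path_count 1 p * path_catalan n.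
Proof.
rewrite /split_count functionalMX -functional_mulr -functional_add; apply: eq_functional => a.
rewrite big_ord_recr /= subnn addn0; congr (_ + _); apply: eq_bigr => x _.
by rewrite subSS -(subnSK (ltn_ord x)) addnS.
Qed.

(** A path of one step has no splitting into nonempty parts but counts 1, whence the coefficient of
    [t]. Splittings with empty second part drop out since [path_catalan 0 = 0]. *)
Lemma path_count_split p : path_count 0 p = split_count 0 p + p`_1.
Proof.
rewrite /path_count /split_count -(functional_coef 1) -functional_add; 
  apply: eq_functional => -[|[|a]].
- by rewrite big_ord0.
- by rewrite big_ord1 /= mulr0 add0r.
rewrite addr0 /= big_ord_recr /= subnn mulr0 addr0.
rewrite catalan_convolution; apply: eq_bigr => x _.
by rewrite subSS subSn // -ltnS.
Qed.

(** [t^k] is paired with [C_(k-2)], that is [path_catalan (k - 1)]: the polygon is opened by taking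
    one of its sides as base. *)
Lemma catalan_pairingE p : catalan_pairing ('X * p) = path_count 0 p.
Proof.
have -> : path_count 0 p = functional (fun k => (1 < k)%:R * (catalan (k - 2))%:R) ('X * p).
  by rewrite functionalMX; apply: eq_functional => -[|k] /=; rewrite ?mul0r // mul1r ?subSS ?subn0.
rewrite /catalan_pairing /functional (big_nat_widenl _ 0) // big_mkord big_mkcond /=.
by apply: eq_bigr => k _; case: ltnP => _; rewrite ?mul1r ?mul0r ?mulr0.
Qed.

End Functionals.

(** * Edge polynomials along a labelled chain *)

Section LabelledPaths.
Variables (e : nat -> nat) (l n : nat).
Hypothesis e_lt : forall i, (i < n)%N -> (e i < l)%N.
Hypothesis e_mono : forall i j, (i <= j)%N -> (j < n)%N -> (e i <= e j)%N.

Definition label_count r i j := (\sum_(i <= g < j) (e g == r))%N.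

(* Gap [g] of the path joins the points [g] and [g.+1], and lies on the edge [e g]. *)
Definition path_poly i j := \prod_(r < l) max_edge_poly (label_count r i j).

Local Notation Q := path_poly.

Lemma label_countS r i j : (i <= j)%N ->
  label_count r i j.+1 = (label_count r i j + (e j == r))%N.
Proof. by move=> ij; rewrite /label_count big_nat_recr. Qed.

Lemma path_poly_id i : Q i i = 1.
Proof.
by rewrite /Q big1 // => r _; rewrite /label_count big_geq // max_edge_poly0.
Qed.

(** Only the factor of edge [e j] changes. If gap [j.-1] of the chain lies on that edge too, the
    three-term recurrence applies; otherwise, labels being monotone, gap [j] opens the edge and the
    new factor is [p_1 = t]. *)
Lemma path_polyS i j : (i <= j)%N -> (j < n)%N ->
  Q i j.+1 = 'X * (Q i j - Q i j.-1 *+ ((i < j)%N && (e j.-1 == e j))).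
Proof.
move=> ij jn; pose r := Ordinal (e_lt jn).
have other k (r' : 'I_l) : r' != r -> (i <= k)%N -> e k = e j ->
  label_count r' i k.+1 = label_count r' i k.
  move=> rr' ik ek; rewrite label_countS // ek -[e j]/(nat_of_ord r).
  by rewrite eq_sym val_eqE (negbTE rr') addn0.
have step k : (i <= k)%N -> e k = e j ->
  label_count r i k.+1 = (label_count r i k).+1.
  by move=> ik ek; rewrite label_countS // ek eqxx addn1.
have split k : Q i k = max_edge_poly (label_count r i k) *
    \prod_(r' < l | r' != r) max_edge_poly (label_count r' i k).
  by rewrite /Q (bigD1 r).
have P k : (i <= k)%N -> e k = e j ->
   \prod_(r' < l | r' != r) max_edge_poly (label_count r' i k.+1) =
   \prod_(r' < l | r' != r) max_edge_poly (label_count r' i k).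
  by move=> ik ek; apply: eq_bigr => r' rr'; rewrite other.
rewrite (split j.+1) P // step // (split j).
case: (boolP (_ && _)) => [/andP[ltij /eqP ej]|same].
  have sj : j = j.-1.+1 by lia.
  have c1 : label_count r i j = (label_count r i j.-1).+1 by rewrite {1}sj step //; lia.
  have := P j.-1; rewrite -sj c1 (split j.-1) => ->; [|lia|by []].
  rewrite max_edge_polySS mulr1n; ring.
rewrite (_ : label_count r i j = 0%N) ?max_edge_poly0 ?max_edge_poly1.
  by rewrite mulr0n subr0 mul1r.
rewrite /label_count big_nat_cond big1 // => g; rewrite andbT => /andP[ig gj].
apply/eqP; rewrite eqb0 /=; apply: contra same => /eqP eg.
have jj : (j.-1 < n)%N by lia.
rewrite (leq_ltn_trans ig gj) eqn_leq e_mono //= ?leq_pred //.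
by rewrite -eg e_mono //; lia.
Qed.

Lemma path_poly_coef0 i j : (i <= j)%N -> (j <= n)%N -> (Q i j)`_0 = (i == j)%:R.
Proof.
case: j => [|j]; first by rewrite leqn0 => /eqP->; rewrite path_poly_id coef1.
rewrite leq_eqVlt => /predU1P[->|ij] jn; first by rewrite path_poly_id coef1 eqxx.
by rewrite path_polyS // coefXM /= ltn_eqF.
Qed.

(** By [p_1 = t], [p_2 = t^2 - t] and the divisibility by [t^2] of the products of all other
    nonempty chains. *)
Lemma path_poly_coef1 i j : (i < j)%N -> (j <= n)%N ->
  (Q i j)`_1 = (j == i.+1)%:R - ((j == i.+2) && (e i == e i.+1))%:R.
Proof.
case: j => // j; rewrite ltnS => ij jn.
rewrite path_polyS // coefXM /= coefB coefMn path_poly_coef0 //; last exact: ltnW.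
rewrite [i == j]eq_sym !eqSS; congr (_ - _).
case: (boolP (_ && _)) => [/andP[ltij ej]|].
  rewrite mulr1n path_poly_coef0; [|lia|lia].
  case: j jn ij ltij ej => // j _ _ _ /= ej; rewrite eqSS [j == i]eq_sym.
  by case: (i =P j) => // ->; rewrite ej.
rewrite mulr0n; case: (j =P i.+1) => //= ->; rewrite leqnn /=.
by move/negbTE->.
Qed.

(** By induction on [j], peeling off the last gap on both sides. Its factor ['X] becomes one more
    appended step, so [m] has to vary. *)
Lemma split_count_path_poly m i j : (i <= j)%N -> (j <= n)%N ->
  split_count m (Q i j) = \sum_(i.+1 <= k < j.+1) path_count 0 (Q i k) * path_count m (Q k j).
Proof.
elim/ltn_ind: j m => -[|j] IH m.
  rewrite leqn0 => /eqP-> _; rewrite path_poly_id big_geq //.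
  by rewrite /split_count functional1 big_ord0.
rewrite leq_eqVlt => /predU1P[->|ij] jn.
  by rewrite path_poly_id big_geq // /split_count functional1 big_ord0.
(* The splitting at [k = j.+1] has an empty second part and accounts for the extra term of
   [split_countMX]. *)
rewrite big_nat_recr //= path_poly_id [path_count m 1]functional1 addn0.
rewrite ltnS in ij; rewrite {1}path_polyS // split_countMX -path_countMX -path_polyS //.
congr (_ + _).
have -> : \sum_(i.+1 <= k < j.+1) path_count 0 (Q i k) * path_count m (Q k j.+1) =
    \sum_(i.+1 <= k < j.+1) path_count 0 (Q i k) * path_count m.+1 (Q k j)
  - \sum_(i.+1 <= k < j.+1) path_count 0 (Q i k) *
      (path_count m.+1 (Q k j.-1) *+ ((k < j)%N && (e j.-1 == e j))).
  rewrite -sumrB; apply: eq_big_nat => k /andP[ik kj].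
  by rewrite path_polyS // path_countMX /path_count functionalB functionalMn mulrBr.
rewrite /split_count functionalB functionalMn -/(split_count m.+1); congr (_ - _).
  by apply: IH => //; exact: ltnW.
case: (boolP (_ && _)) => [/andP[ltij ej]|same]; last first.
  rewrite mulr0n big_nat_cond big1 // => k; rewrite andbT => /andP[ik kj].
  case: (boolP (_ && _)) => [/andP[ltkj ej]|]; last by rewrite mulr0n mulr0.
  by move: same; rewrite ej (leq_trans ik _).
case: j jn ij ltij ej IH => // j jn _ ij /= ej IH.
rewrite mulr1n big_nat_recr //= ltnn mulr0n mulr0 addr0 IH; [|lia..].
by apply: eq_big_nat => k /andP[_ kj]; rewrite kj ej.
Qed.

Lemma path_count_path_poly i j : (i < j)%N -> (j <= n)%N ->
  path_count 0 (Q i j) =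
    \sum_(i.+1 <= k < j) path_count 0 (Q i k) * path_count 0 (Q k j) + (Q i j)`_1.
Proof.
move=> ij jn; rewrite path_count_split split_count_path_poly //; last exact: ltnW.
by rewrite big_nat_recr //= path_poly_id [path_count 0 1]functional1 mulr0 addr0.
Qed.

(** By induction only the splitting of a two-step chain contributes, and its 1 cancels the
    coefficient -1 of [t] in [p_2]. *)
Lemma path_count_path_poly_flat i j : (i < j)%N -> (j <= n)%N -> e i = e j.-1 ->
  path_count 0 (Q i j) = (j == i.+1)%:R.
Proof.
move: {2}(j - i)%N (leqnn (j - i)) => d; elim: d i j => [|d IH] i j; first by lia.
move=> jid ij jn eij.
have eik k : (i <= k < j)%N -> e k = e i.
  move=> /andP[ik kj]; apply/eqP; rewrite eqn_leq [X in (_ <= X)%N && _]eij !e_mono //; lia.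
rewrite path_count_path_poly // path_poly_coef1 //.
have -> : \sum_(i.+1 <= k < j) path_count 0 (Q i k) * path_count 0 (Q k j) =
   \sum_(i.+1 <= k < j) ((k == i.+1) && (j == i.+2))%:R.
  apply: eq_big_nat => k /andP[ik kj].
  have -> : path_count 0 (Q i k) = (k == i.+1)%:R by apply: IH; rewrite ?eik //; lia.
  have -> : path_count 0 (Q k j) = (j == k.+1)%:R by apply: IH; rewrite ?(eik k) //; lia.
  rewrite -natrM mulnb; congr (nat_of_bool _)%:R.
  by case: (k =P i.+1) => [->|].
case: (ltnP i.+1 j) => ij1; last first.
  have /negbTE-> : j != i.+2 by lia.
  by rewrite big_geq //= add0r subr0.
rewrite (big_ltn ij1) eqxx big_nat_cond big1 ?addr0; last first.
  by move=> k /andP[/andP[ik _] _]; have /negbTE-> : k != i.+1 by lia.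
rewrite (eik i.+1) ?eqxx ?andbT /=; [ring|lia].
Qed.

End LabelledPaths.

Lemma path_count_subMn m p q (b : bool) :
  path_count m (p - q *+ b) = path_count m p - path_count m q *+ b.
Proof. by rewrite /path_count functionalB functionalMn. Qed.

Lemma catalan_pairing_path_poly (e : nat -> nat) l n :
  (1 < n)%N -> e 0%N != e n.-1 ->
  (forall i, (i <= n)%N -> (e i < l)%N) ->
  (forall i j, (i <= j)%N -> (j <= n)%N -> (e i <= e j)%N) ->
  catalan_pairing (path_poly e l 0 n.+1) =
  \sum_(1 <= k < n | e k != e n)
    path_count 0 (path_poly e l 0 k) * path_count 0 (path_poly e l k n).
Proof.
move=> n1 en el em; have n0 : (0 < n)%N by exact: ltnW.
rewrite (@path_polyS e l n.+1) // catalan_pairingE path_count_subMn n0 andTb.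
rewrite (@path_count_path_poly e l n.+1) // (@path_poly_coef1 e l n.+1) //.
have -> : (n == 1%N) = false by apply/negbTE; rewrite neq_ltn n1 orbT.
have -> : (n == 2) && (e 0 == e 1) = false.
  by apply: contraNF en => /andP[/eqP-> /eqP->].
rewrite [_%:R - _]subrr addr0 (bigID (fun k => e k == e n)) /= -[RHS]add0r addrAC; congr (_ + _).
(* For an apex on the last edge the flat chain from [k] to [n] counts 0 unless [k = n.-1]; this one
   term cancels the one subtracted by [path_polyS]. *)
have -> : \sum_(1 <= k < n | e k == e n)
     path_count 0 (path_poly e l 0 k) * path_count 0 (path_poly e l k n) =
   \sum_(1 <= k < n | e k == e n) path_count 0 (path_poly e l 0 k) *+ (k == n.-1).
  rewrite big_nat_cond [RHS]big_nat_cond; apply: eq_bigr => k.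
  move=> /andP[/andP[k1 kn] /eqP ek].
  have knp : (k <= n.-1)%N by rewrite -ltnS prednK.
  have -> : path_count 0 (path_poly e l k n) = (n == k.+1)%:R.
    apply: (@path_count_path_poly_flat e l n.+1) => //.
    by apply/eqP; rewrite eqn_leq (em _ _ knp (leq_pred n)) ek (em _ _ (leq_pred n)).
  rewrite mulr_natr; congr (_ *+ nat_of_bool _).
  by rewrite -{1}(prednK n0) eqSS eq_sym.
rewrite big_mkcond (bigD1_seq n.-1) ?iota_uniq ?mem_index_iota //=; last first.
  by case: (n) n1 => [|[|n']] //= _; rewrite ltnSn.
rewrite eqxx big1 ?addr0; last by move=> k /negbTE->; rewrite mulr0n if_same.
by case: eqP => _; rewrite ?mulr1n ?mulr0n ?subrr ?subr0 ?addNr ?oppr0 ?addr0.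
Qed.

(** * Convex hulls and triangles in the plane *)

Local Open Scope classical_set_scope.

Section ConvexHulls.
Variable R : realType.
Implicit Types (x y z p : plane R) (S A B : set (plane R)) (t : R) (f : plane R -> R).

Definition mix t x y : plane R := (1 - t) *: x + t *: y.

Definition affine f := forall t x y, f (mix t x y) = (1 - t) * f x + t * f y.

Lemma mix0 x y : mix 0 x y = x.
Proof. by rewrite /mix subr0 scale1r scale0r addr0. Qed.

Lemma mix1 x y : mix 1 x y = y.
Proof. by rewrite /mix subrr scale1r scale0r add0r. Qed.

Lemma mixxx t x : mix t x x = x.
Proof. by rewrite /mix -scalerDl subrK scale1r. Qed.

Lemma planeP x y : x 0 0 = y 0 0 -> x 0 1 = y 0 1 -> x = y.
Proof.
move=> h0 h1; apply/rowP => i; have [->|->] : i = 0 \/ i = 1 by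
  case: i => [[|[|//]] hi]; [left|right]; apply: val_inj.
  exact: h0.
exact: h1.
Qed.

Lemma mixE t x y i : mix t x y 0 i = (1 - t) * x 0 i + t * y 0 i.
Proof. by rewrite !mxE. Qed.

Lemma convex_setP A : @convex_set R (plane R) A <->
  (forall t x y, 0 <= t <= 1 -> A x -> A y -> A (mix t x y)).
Proof.
split=> [cA t x y /andP[t0 t1] Ax Ay|cA x y t]; last first.
  rewrite !inE => Ax Ay; rewrite /conv /= addrC -/(mix t%:num y x).
  by apply: cA => //; rewrite ge0 /=.
have := cA y x (Itv01 t0 t1); rewrite !inE => /(_ Ay Ax).
by rewrite /conv /= /mix addrC.
Qed.

Lemma hull_mix S t x y : 0 <= t <= 1 ->
  convex_hull S x -> convex_hull S y -> convex_hull S (mix t x y).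
Proof.
move=> t01 Sx Sy A [cA SA]; move/convex_setP: (cA); apply=> //.
- by apply: Sx.
- by apply: Sy.
Qed.

Lemma sub_hull S : S `<=` convex_hull S. Proof. exact: sub_gen_smallest. Qed.

Lemma hull_ind S A : S `<=` A ->
  (forall t x y, 0 <= t <= 1 -> A x -> A y -> A (mix t x y)) ->
  convex_hull S `<=` A.
Proof. by move=> SA /convex_setP cA; apply: smallest_sub. Qed.

Lemma hull_sub S A : S `<=` convex_hull A -> convex_hull S `<=` convex_hull A.
Proof. by move=> SA; apply: hull_ind => // t x y; apply: hull_mix. Qed.

Lemma hull_mono S A : S `<=` A -> convex_hull S `<=` convex_hull A.
Proof. by move=> SA; apply: hull_sub => x /SA /sub_hull. Qed.

Lemma hull_set0 : convex_hull (@set0 (plane R)) = set0.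
Proof. by rewrite -subset0; apply: hull_ind. Qed.

Lemma hull_set1 x : convex_hull [set x] = [set x].
Proof.
apply/seteqP; split; last exact: sub_hull.
by apply: hull_ind => // t y z _ /= -> ->; rewrite mixxx.
Qed.

Lemma segmentP x y z : segment x y z <-> exists2 t, 0 <= t <= 1 & z = mix t x y.
Proof.
split=> [|[t t01 ->]]; last by apply: hull_mix => //; apply: sub_hull; [left|right].
move: z; apply: hull_ind => [z [->|->]|t a b /andP[t0 t1] [r /andP[r0 r1] ->] [s /andP[s0 s1] ->]].
- by exists 0; rewrite ?mix0 // lexx ler01.
- by exists 1; rewrite ?mix1 // lexx ler01.
exists ((1 - t) * r + t * s); last by apply: planeP; rewrite !mixE; ring.
by apply/andP; split; nra.
Qed.

Lemma segmentC x y : segment x y = segment y x.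
Proof. by rewrite /segment setUC. Qed.

Lemma affine_hull f c S : affine f -> (forall x, S x -> c <= f x) ->
  forall x, convex_hull S x -> c <= f x.
Proof.
move=> af Sf; apply: hull_ind => // t x y /andP[t0 t1] fx fy.
by rewrite af; nra.
Qed.

Lemma affineN f : affine f -> affine (fun x => - f x).
Proof. by move=> af t x y; rewrite af; ring. Qed.

Lemma affine_hull_le f c S : affine f -> (forall x, S x -> f x <= c) ->
  forall x, convex_hull S x -> f x <= c.
Proof.
move=> af Sf x /(affine_hull (c := - c) (affineN af)) h.
by rewrite -lerN2; apply: h => y Sy; rewrite lerN2 Sf.
Qed.

(** In a mixture with positive weights two nonnegative values of [f] add up to 0 only if both
    vanish; for this the induction carries [0 <= f x] along. *)
Lemma hull_face f S : affine f -> (forall x, S x -> 0 <= f x) ->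
  forall x, convex_hull S x -> f x = 0 -> convex_hull (S `&` [set y | f y = 0]) x.
Proof.
move=> af Sf; suff : convex_hull S `<=` [set x | 0 <= f x /\
    (f x = 0 -> convex_hull (S `&` [set y | f y = 0]) x)].
  by move=> h x /h[].
apply: hull_ind => [x Sx|t x y /andP[t0 t1] [fx hx] [fy hy]] /=.
  by split=> [|f0]; [exact: Sf|apply: sub_hull].
rewrite af; split=> [|e]; first by nra.
have [tz|tn] := eqVneq t 0; first by move: e; rewrite tz mix0 => e; apply: hx; lra.
have [to|tn1] := eqVneq t 1; first by move: e; rewrite to mix1 => e; apply: hy; lra.
have t0' : 0 < t by rewrite lt_neqAle eq_sym tn.
have t1' : t < 1 by rewrite lt_neqAle tn1.
by apply: hull_mix; [rewrite t0 t1|apply: hx; nra|apply: hy; nra].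
Qed.

(** [x] and [y] witness that both sets are nonempty, so that a point of one of them is a mixture of
    weight 0 or 1. *)
Lemma hull_join A B x y : A x -> B y -> forall z, convex_hull (A `|` B) z ->
  exists a b t, [/\ convex_hull A a, convex_hull B b, 0 <= t <= 1 & z = mix t a b].
Proof.
move=> Ax By; apply: hull_ind => [z [Az|Bz]|].
- by exists z, y, 0; split; rewrite ?mix0 ?lexx ?ler01 //; apply: sub_hull.
- by exists x, z, 1; split; rewrite ?mix1 ?lexx ?ler01 //; apply: sub_hull.
move=> t z z' /andP[t0 t1] [a [b [r [Aa Bb /andP[r0 r1] ->]]]].
move=> [a' [b' [s [Aa' Bb' /andP[s0 s1] ->]]]].
(* Regroups a nonnegative combination within one hull; total weight 0 is treated apart because
   normalising would divide by it. *)
have comb S u v c d : 0 <= c -> 0 <= d -> convex_hull S u -> convex_hull S v ->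
    exists2 w, convex_hull S w & c *: u + d *: v = (c + d) *: w.
  move=> c0 d0 Su Sv; have [cd|cd] := eqVneq (c + d) 0.
    have [-> ->] : c = 0 /\ d = 0 by split; lra.
    by exists u => //; rewrite !scale0r addr0 add0r scale0r.
  exists (mix (d / (c + d)) u v).
    apply: hull_mix => //; rewrite divr_ge0 ?addr_ge0 //=.
    by rewrite ler_pdivrMr ?mul1r ?lerDr // lt_neqAle eq_sym cd addr_ge0.
  by rewrite /mix scalerDr !scalerA; congr (_ *: _ + _ *: _); field.
have [w Aw ew] := comb A a a' ((1 - t) * (1 - r)) (t * (1 - s)) ltac:(nra) ltac:(nra) Aa Aa'.
have [w' Bw' ew'] := comb B b b' ((1 - t) * r) (t * s) ltac:(nra) ltac:(nra) Bb Bb'.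
exists w, w', ((1 - t) * r + t * s); split=> //; first by apply/andP; split; nra.
rewrite [RHS]/mix -ew' (_ : 1 - _ = (1 - t) * (1 - r) + t * (1 - s)) -?ew; last by ring.
by rewrite /mix !scalerDr !scalerA addrACA.
Qed.

End ConvexHulls.

(** * Signed areas and separation in the plane *)

Section Orientation.
Variable R : realType.
Implicit Types (a b c d p x y z u v w : plane R) (S A B : set (plane R)).

Lemma orient_rot a b c : orient a b c = orient b c a.
Proof. by rewrite /orient; ring. Qed.

Lemma orient_swap a b c : orient b a c = - orient a b c.
Proof. by rewrite /orient; ring. Qed.

Lemma orient_swapr a b c : orient a c b = - orient a b c.
Proof. by rewrite /orient; ring. Qed.

Lemma orient_aa a b : orient a a b = 0.
Proof. by rewrite /orient; ring. Qed.

Lemma orient_aba a b : orient a b a = 0.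
Proof. by rewrite /orient; ring. Qed.

Lemma orient_abb a b : orient a b b = 0.
Proof. by rewrite /orient; ring. Qed.

Lemma affine_orient a b : affine (orient a b).
Proof. by move=> t x y; rewrite /orient !mixE; ring. Qed.

(** Both sides are twice the signed area of the quadrilateral [abcd], cut along either diagonal. *)
Lemma orient_area a b c d :
  orient a b c + orient a c d = orient a b d + orient b c d.
Proof. by rewrite /orient; ring. Qed.

Lemma orient_pluecker o a b c d :
  orient o a b * orient o c d - orient o a c * orient o b d
    + orient o a d * orient o b c = 0.
Proof. by rewrite /orient; ring. Qed.

Lemma barycentric a b c p (i : 'I_2) : orient a b c * p 0 i =
  orient b c p * a 0 i + orient c a p * b 0 i + orient a b p * c 0 i.
Proof.
have [->|->] : i = 0 \/ i = 1 by
  case: i => [[|[|//]] hi]; [left|right]; apply: val_inj.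
  by rewrite /orient; ring.
by rewrite /orient; ring.
Qed.

Lemma orient_sum a b c p :
  orient a b p + orient b c p + orient c a p = orient a b c.
Proof. by rewrite /orient; ring. Qed.

Lemma collinear_mix a b c : a != b -> orient a b c = 0 -> exists t, c = mix t a b.
Proof.
move=> ab; rewrite /orient => h; have [e0|n0] := eqVneq (b 0 0) (a 0 0).
  have n1 : b 0 1 - a 0 1 != 0.
    by rewrite subr_eq0; apply: contraNneq ab => e1; apply/eqP/planeP.
  have e : c 0 0 = a 0 0.
    by move: h; rewrite e0 subrr mul0r sub0r => /eqP; rewrite oppr_eq0 mulf_eq0
      (negbTE n1) subr_eq0 => /eqP.
  exists ((c 0 1 - a 0 1) / (b 0 1 - a 0 1)); apply: planeP; rewrite mixE.
    by rewrite e e0; ring.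
  by field.
have n1 : b 0 0 - a 0 0 != 0 by rewrite subr_eq0.
exists ((c 0 0 - a 0 0) / (b 0 0 - a 0 0)); apply: planeP; rewrite mixE; first by field.
apply: (mulfI n1); move/eqP: h; rewrite subr_eq0 => /eqP h.
rewrite (_ : c 0 1 = c 0 1 - a 0 1 + a 0 1); last by ring.
by rewrite mulrDr h; field.
Qed.

Lemma collinear_trans a b x y z : a != b -> orient a b x = 0 -> orient a b y = 0 ->
  orient a b z = 0 -> orient x y z = 0.
Proof.
move=> ab /(collinear_mix ab)[r ->] /(collinear_mix ab)[s ->] /(collinear_mix ab)[t ->].
by rewrite /orient !mixE; ring.
Qed.

Lemma divr_itv01 (r s : R) : 0 <= r -> r <= s -> 0 < s -> 0 <= r / s <= 1.
Proof. by move=> r0 rs s0; rewrite divr_ge0 ?(ltW s0) //= ler_pdivrMr // mul1r. Qed.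

Lemma triangle_hull S a b c p : S a -> S b -> S c -> 0 < orient a b c ->
  0 <= orient a b p -> 0 <= orient b c p -> 0 <= orient c a p -> convex_hull S p.
Proof.
move=> Sa Sb Sc A0 h1 h2 h3; have es := orient_sum a b c p.
have ep := barycentric a b c p.
have An : orient a b c != 0 by rewrite gt_eqF.
(* If [b] and [c] both have weight 0 then [p = a]; otherwise [p] lies between [a] and the point
   where the ray from [a] through [p] meets [bc]. *)
have [s0|sn] := eqVneq (orient c a p + orient a b p) 0.
  have [e1 e3] : orient a b p = 0 /\ orient c a p = 0 by split; lra.
  suff -> : p = a by apply: sub_hull.
  have e2 : orient b c p = orient a b c by lra.
  by apply: planeP; apply: (mulfI An); rewrite ep e1 e2 e3; ring.
have s1 : 0 < orient c a p + orient a b p by rewrite lt_neqAle eq_sym sn addr_ge0.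
have -> : p = mix ((orient c a p + orient a b p) / orient a b c) a
   (mix (orient a b p / (orient c a p + orient a b p)) b c).
  apply: planeP; rewrite !mixE; apply: (mulfI An); rewrite ep -es; field;
  by rewrite es An sn.
apply: hull_mix.
- by apply: divr_itv01 => //; lra.
- exact: sub_hull.
apply: hull_mix; try exact: sub_hull.
by apply: divr_itv01 => //; lra.
Qed.

(** The diagonals of a possibly degenerate convex quadrilateral; each parameter is the share of one
    triangle in the total area. *)
Lemma segments_cross a b c d : 0 <= orient a b c -> 0 <= orient a c d ->
  0 <= orient a b d -> 0 <= orient b c d -> 0 < orient a b c + orient a c d ->
  exists2 z, segment a c z & segment b d z.
Proof.
move=> h1 h2 h3 h4 s0; have es := orient_area a b c d.
have sn : orient a b c + orient a c d != 0 by rewrite gt_eqF.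
exists (mix (orient a b d / (orient a b c + orient a c d)) a c).
  apply/segmentP; exists (orient a b d / (orient a b c + orient a c d)) => //.
  by apply: divr_itv01 => //; lra.
apply/segmentP; exists (orient a b c / (orient a b c + orient a c d)).
  by apply: divr_itv01 => //; lra.
by apply: planeP; rewrite !mixE; apply: (mulfI sn); rewrite /orient; field;
  move: sn; rewrite /orient.
Qed.

(* If [p] lies strictly on the [A]-side of the line through [x] and [y], the
   segment from a point of [hull A] to a point of [hull B] through [p] crosses
   that line after [p], and the two supporting lines [h1] and [h2] force it to do
   so between [x] and [y]. *)
Lemma hull_cut (f h1 h2 : plane R -> R) A B x y p :
  affine f -> affine h1 -> affine h2 -> A x -> A y -> B y -> x != y ->
  (forall z, f z = 0 -> orient x y z = 0) ->
  (forall z, B z -> f z <= 0) ->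
  (forall z, A z \/ B z -> 0 <= h1 z) -> h1 y = 0 -> 0 < h1 x ->
  (forall z, A z \/ B z -> 0 <= h2 z) -> h2 x = 0 -> 0 < h2 y ->
  convex_hull (A `|` B) p -> 0 < f p -> convex_hull A p.
Proof.
move=> af a1 a2 Ax Ay By xy fxy Bf h1p h1y h1x h2p h2x h2y.
move=> /(hull_join Ay By)[a [b [t [Aa Bb /andP[t0 t1] ->]]]].
have fb : f b <= 0 by apply: (affine_hull_le af Bf).
rewrite af => fp; have fa : 0 < f a by nra.
have dn : f a - f b != 0 by apply: lt0r_neq0; lra.
have d0 : 0 < f a - f b by lra.
pose m := f a / (f a - f b); pose z := mix m a b.
have m0 : 0 < m by rewrite divr_gt0.
have m1 : m <= 1 by rewrite ler_pdivrMr // mul1r; lra.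
have tm : t <= m by rewrite ler_pdivlMr //; nra.
have Hz : convex_hull (A `|` B) z.
  apply: hull_mix; first by rewrite (ltW m0).
  - by move: Aa; apply: hull_mono; left.
  - by move: Bb; apply: hull_mono; right.
have fz : f z = 0 by rewrite af /m; field.
have [r ez] := collinear_mix xy (fxy _ fz).
have := affine_hull a1 h1p Hz; rewrite ez a1 h1y mulr0 addr0 => r1.
have := affine_hull a2 h2p Hz; rewrite ez a2 h2x mulr0 add0r => r0.
have Az : convex_hull A z.
  rewrite ez; apply: hull_mix; try exact: sub_hull.
  by rewrite -(pmulr_lge0 _ h2y) r0 /= -subr_ge0 -(pmulr_lge0 _ h1x).
have -> : mix t a b = mix (t / m) a z.
  have mn : m != 0 by rewrite gt_eqF.
  by apply: planeP; rewrite /z !mixE; field.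
by apply: hull_mix => //; apply: divr_itv01.
Qed.

End Orientation.

(** * Triangles that meet properly *)

Section Triangles.
Variable R : realType.
Implicit Types (a b c d p x y z u v w : plane R) (t s : {fset plane R}).
Implicit Types (T : {fset {fset plane R}}).

Definition ccw_triangle t :=
  exists a b c, t = [fset a; b; c]%fset /\ 0 < orient a b c.

Lemma in_fset3 a b c x : (x \in [fset a; b; c]%fset) = [|| x == a, x == b | x == c].
Proof. by rewrite !inE orbA. Qed.

Lemma nondegenerate_ccw t : nondegenerate_triangle t <-> ccw_triangle t.
Proof.
split=> -[a [b [c [-> h]]]]; last by exists a, b, c; rewrite gt_eqF.
move: h; rewrite neq_lt => /orP[h|h]; last by exists a, b, c.
exists b, a, c; rewrite orient_swap oppr_gt0; split=> //.
by apply/fsetP => x; rewrite !in_fset3 orbCA.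
Qed.

(** Up to a positive factor, [f] is the barycentric coordinate of [x]. *)
Lemma opposite_functional t x : nondegenerate_triangle t -> x \in t ->
  exists f : plane R -> R,
    [/\ affine f, 0 < f x & forall y, y \in t -> y != x -> f y = 0].
Proof.
move=> [a [b [c [-> h]]]]; rewrite in_fset3.
have main u v w : orient u v w != 0 -> exists f : plane R -> R,
    [/\ affine f, 0 < f u, f v = 0 & f w = 0].
  (* Multiplying by the value at [u] makes that value a square, hence positive for either
     orientation. *)
  move=> n; exists (fun p => orient v w p * orient v w u); split.
  - by move=> t' y z; rewrite affine_orient; ring.
  - by rewrite -expr2 exprn_even_gt0 // -orient_rot.
  - by rewrite orient_aba mul0r.
  - by rewrite orient_abb mul0r.
move=> /or3P[]/eqP->.
- have [f [af f1 f2 f3]] := main a b c h.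
  by exists f; split=> // y; rewrite in_fset3 => /or3P[]/eqP-> //; rewrite eqxx.
- have [|f [af f1 f2 f3]] := main b c a; first by rewrite -orient_rot.
  by exists f; split=> // y; rewrite in_fset3 => /or3P[]/eqP-> //; rewrite eqxx.
have [|f [af f1 f2 f3]] := main c a b; first by rewrite orient_rot.
by exists f; split=> // y; rewrite in_fset3 => /or3P[]/eqP-> //; rewrite eqxx.
Qed.

(** The barycentric coordinate of [a] is positive at [z], while on [segment u v] it vanishes unless
    [a] is one of the ends. *)
Lemma edge_vertex t a c u v z : nondegenerate_triangle t ->
  a \in t -> c \in t -> u \in t -> v \in t ->
  segment a c z -> z != c -> segment u v z -> a = u \/ a = v.
Proof.
move=> nt ta tc tu tv /segmentP[r /andP[r0 r1] ->] zc /segmentP[s _ e].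
have [f [af fa fy]] := opposite_functional nt ta.
have [->|au] := eqVneq a u; [by left|]; have [->|av] := eqVneq a v; [by right|].
have := congr1 f e; rewrite !af (fy u) // 1?eq_sym // (fy v) // 1?eq_sym //.
have fc : 0 <= f c by have [->|/(fy _ tc)->] := eqVneq c a; rewrite ?lexx ?ltW.
have rn : r != 1 by apply: contraNneq zc => ->; rewrite mix1.
have r1' : r < 1 by rewrite lt_neqAle rn.
have fa' : 0 < (1 - r) * f a by rewrite mulr_gt0 // subr_gt0.
have rc : 0 <= r * f c by rewrite mulr_ge0.
by move=> h; have := ltr_wpDr rc fa'; rewrite h !mulr0 addr0 ltxx.
Qed.

Lemma vertex_segment t x u v : nondegenerate_triangle t ->
  x \in t -> u \in t -> v \in t -> segment u v x -> x = u \/ x = v.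
Proof.
move=> nt tx tu tv /segmentP[s _ e].
have [f [af xx fy]] := opposite_functional nt tx.
have [->|xu] := eqVneq x u; [by left|]; have [->|xv] := eqVneq x v; [by right|].
have := congr1 f e; rewrite !af (fy u) // 1?eq_sym // (fy v) // 1?eq_sym //.
by move=> h; move: xx; rewrite h !mulr0 addr0 ltxx.
Qed.

Lemma segment_hull t u v : u \in t -> v \in t -> segment u v `<=` hull t.
Proof. by move=> tu tv; apply: hull_mono => x [->|->]. Qed.

Lemma vertex_hull t v : v \in t -> hull t v.
Proof. by move=> tv; apply: sub_hull. Qed.

Lemma meet_properlyC s t : meet_properly s t -> meet_properly t s.
Proof. by rewrite /meet_properly fsetIC setIC. Qed.

(** Vertices of [s] are extreme in [hull s], so on a common edge [c] can only be an end of it. *)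
Lemma meet_properly_vertex s t c : nondegenerate_triangle s -> meet_properly s t ->
  c \in s -> hull t c -> c \in t.
Proof.
move=> ns m sc tc; case: m => [e|[v]|[u [v []]]].
- suff : (hull s `&` hull t) c by rewrite e.
  by split=> //; apply: vertex_hull.
- rewrite inE => /andP[_ tv] e; suff -> : c = v by [].
  suff : (hull s `&` hull t) c by rewrite e.
  by split=> //; apply: vertex_hull.
rewrite !inE => /andP[su tu] /andP[sv tv] _ e.
have : (hull s `&` hull t) c by split=> //; apply: vertex_hull.
by rewrite e => /(vertex_segment ns sc su sv)[]->.
Qed.

(** The crossing point [z] is none of the four ends, so a common vertex is impossible; a common edge
    through [z] would have [a], [b] and [c] among its two ends. *)
Lemma meet_properly_no_crossing s t a b c d z :
  nondegenerate_triangle s -> nondegenerate_triangle t -> meet_properly s t ->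
  a \in s -> c \in s -> b \in t -> d \in t ->
  a != c -> b != d -> a != b -> a != d -> c != b -> c != d ->
  segment a c z -> segment b d z -> False.
Proof.
move=> ns nt m sa sc tb td ac bd ab ad cb cd zac zbd.
have off s' t' x u v : nondegenerate_triangle s' -> nondegenerate_triangle t' ->
    meet_properly s' t' -> x \in s' -> u \in t' -> v \in t' -> x != u -> x != v ->
    segment u v z -> z != x.
  move=> ns' nt' m' xs' ut' vt' xu xv zuv; apply/eqP => zx.
  have xt' : x \in t'.
    apply: (meet_properly_vertex ns' m') => //; rewrite -zx.
    exact: (segment_hull ut' vt').
  rewrite zx in zuv; have [e|e] := vertex_segment nt' xt' ut' vt' zuv.
    by rewrite e eqxx in xu.
  by rewrite e eqxx in xv.
have za : z != a by apply: (off s t a b d).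
have zc : z != c by apply: (off s t c b d).
have zb : z != b by apply: (off t s b a c) => //; [exact: meet_properlyC|rewrite eq_sym..].
have zd : z != d by apply: (off t s d a c) => //; [exact: meet_properlyC|rewrite eq_sym..].
have zst : (hull s `&` hull t) z.
  by split; [exact: (segment_hull sa sc)|exact: (segment_hull tb td)].
case: m => [e|[v]|[u [v []]]].
- by rewrite e in zst.
- rewrite inE => /andP[sv _] e; rewrite e in zst.
  have [ez|ez] : z = a \/ z = c by apply: (vertex_segment ns) => //; rewrite zst.
    by rewrite ez eqxx in za.
  by rewrite ez eqxx in zc.
rewrite !inE => /andP[su tu] /andP[sv tv] _ e; rewrite e in zst.
have zca : segment c a z by rewrite segmentC.
have zdb : segment d b z by rewrite segmentC.
have := edge_vertex ns sa sc su sv zac zc zst.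
have := edge_vertex ns sc sa su sv zca za zst.
have := edge_vertex nt tb td tu tv zbd zd zst.
move=> [] eb [] ec [] ea; move: ac ab cb; by rewrite eb ec ea ?eqxx.
Qed.

(* Triangles are closed. *)
Lemma ccw_triangle_leave t p w : ccw_triangle t -> ~ hull t p ->
  exists2 e, 0 < e <= 1 & forall r, 0 <= r <= e -> ~ hull t (mix r p w).
Proof.
move=> [a [b [c [-> h]]]] np.
have leave (f : plane R -> R) : affine f ->
    (forall x, x \in [fset a; b; c]%fset -> 0 <= f x) -> f p < 0 ->
    exists2 e, 0 < e <= 1 &
      forall r, 0 <= r <= e -> ~ hull [fset a; b; c]%fset (mix r p w).
  move=> af f0 fp; pose D := `|f w| + `|f p| + 1.
  have D0 : 0 < D by rewrite ltr_wpDl ?addr_ge0.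
  have D1 : - f p <= D.
    by rewrite /D; have := normr_ge0 (f w); have := ler_norm (- f p); rewrite normrN; lra.
  exists (- f p / (D *+ 2)).
    rewrite divr_gt0 ?oppr_gt0 ?mulrn_wgt0 //= ler_pdivrMr ?mulrn_wgt0 //.
    by rewrite mul1r mulr2n; lra.
  move=> r /andP[r0]; rewrite ler_pdivlMr ?mulrn_wgt0 // => r1.
  move=> /(affine_hull af f0); rewrite af.
  have : f w <= `|f w| by apply: ler_norm.
  have : - f p <= `|f p| by rewrite -normrN ler_norm.
  have := normr_ge0 (f w).
  rewrite -/D in r1; rewrite mulr2n in r1; rewrite /D in r1 => n1 n2 n3 n4.
  have : r * (f w - f p) <= r * (`|f w| + `|f p| + 1) by apply: ler_wpM2l; lra.
  clear np D0 D1; lra.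
case: (ltP (orient a b p) 0) => h1.
  apply: leave h1; first exact: affine_orient.
  by move=> x; rewrite in_fset3 => /or3P[]/eqP->; rewrite ?orient_aba ?orient_abb // ltW.
case: (ltP (orient b c p) 0) => h2.
  apply: leave h2; first exact: affine_orient.
  move=> x; rewrite in_fset3 => /or3P[]/eqP->; rewrite ?orient_aba ?orient_abb //.
  by rewrite -orient_rot ltW.
case: (ltP (orient c a p) 0) => h3.
  apply: leave h3; first exact: affine_orient.
  move=> x; rewrite in_fset3 => /or3P[]/eqP->; rewrite ?orient_aba ?orient_abb //.
  by rewrite orient_rot ltW.
by case: np; apply: (@triangle_hull _ _ a b c) => //=; rewrite in_fset3 eqxx ?orbT.
Qed.

(** If no triangle contained [p], each would miss an initial piece of the segment from [p] to [w],
    and finitely many such pieces have a common one. *)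
Lemma triangles_cover_limit T p w : (forall t, t \in T -> ccw_triangle t) ->
  (forall r, 0 < r <= 1 -> exists2 t, t \in T & hull t (mix r p w)) ->
  exists2 t, t \in T & hull t p.
Proof.
move=> Tt cov; apply: contrapT => nT.
have out t : t \in T -> ~ hull t p by move=> tT tp; apply: nT; exists t.
have [e /andP[e0 e1] He] : exists2 e, 0 < e <= 1 &
    forall t, t \in enum_fset T -> forall r, 0 <= r <= e -> ~ hull t (mix r p w).
  have : {subset enum_fset T <= T} by [].
  elim: (enum_fset T) => [|t s IH] sT; first by exists 1; rewrite ?ltr01 ?lexx.
  have [|e /andP[e0 e1] He] := IH; first by move=> x xs; apply: sT; rewrite inE xs orbT.
  have tT : t \in T by apply: sT; rewrite inE eqxx.
  have [e' /andP[e0' e1'] He'] := ccw_triangle_leave w (Tt t tT) (out t tT).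
  exists (Order.min e e'); first by rewrite lt_min e0 e0' ge_min e1.
  move=> x; rewrite inE => /predU1P[->|xs] r /andP[r0]; rewrite le_min => /andP[r1 r2].
    by apply: He'; rewrite r0.
  by apply: He => //; rewrite r0.
have [|t tT] := cov e; first by rewrite e0.
by apply: He; rewrite // lexx ltW.
Qed.

End Triangles.

(** * Triangulations of convex chains *)

Section Chains.
Variables (R : realType) (q : nat -> plane R) (m : nat).
Implicit Types (i j k a b c r : nat) (p : plane R) (t s : {fset plane R}).
Implicit Types (T : {fset {fset plane R}}).

Hypothesis q_inj : forall a b, (a <= m)%N -> (b <= m)%N -> q a = q b -> a = b.

Local Notation orientq a b c := (orient (q a) (q b) (q c)).

Definition points i j : set (plane R) := [set x | exists2 k, (i <= k <= j)%N & x = q k].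

Definition tri a b c : {fset plane R} := [fset q a; q b; q c]%fset.

Definition is_tri i j t := exists a b c,
  [/\ (i <= a)%N, (a < b)%N, (b < c)%N & (c <= j)%N] /\ t = tri a b c /\ 0 < orientq a b c.

Definition ccw_chain i j := forall a b c,
  (i <= a)%N -> (a <= b)%N -> (b <= c)%N -> (c <= j)%N -> 0 <= orientq a b c.

(** [ccw_chain] says nothing about the order of collinear points; the second clause makes them
    follow each other along their line. *)
Definition convex_chain i j := ccw_chain i j /\ forall a b c,
  (i <= a)%N -> (a < b)%N -> (b < c)%N -> (c <= j)%N -> orientq a b c = 0 ->
  segment (q a) (q c) (q b).

(* A closed convex chain whose base segment, from [q j] to [q i], may lie on the
   same line as points of the chain that follow or precede it. *)
Definition convex_loop i j :=
  [/\ ccw_chain i j,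
      forall k, (i < k)%N -> (k < j)%N -> 0 < orientq i k j ->
        convex_chain i k /\ convex_chain k j
    & forall k r, (i < r)%N -> (r < j)%N -> 0 < orientq i r j ->
        (i < k)%N -> (k < j)%N -> orientq i k j = 0 -> segment (q k) (q i) (q j)].

(* For [j = i.+1] the only such [T] is empty, and if the points are collinear and
   [i.+1 < j] there is none. *)
Definition chain_triangulation i j T :=
  [/\ forall t, t \in T -> is_tri i j t,
      forall p, convex_hull (points i j) p -> 0 < orient (q j) (q i) p ->
        exists2 t, t \in T & hull t p,
      forall s t, s \in T -> t \in T -> s != t -> meet_properly s t,
      forall k, (i < k)%N -> (k < j)%N -> exists2 t, t \in T & q k \in t
    & forall t k, t \in T -> (i <= k <= j)%N -> hull t (q k) -> q k \in t].

Lemma q_neq a b : (a < b)%N -> (b <= m)%N -> q a != q b.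
Proof.
move=> ab bm; apply/eqP => h.
by have e := q_inj (ltnW (leq_trans ab bm)) bm h; rewrite e ltnn in ab.
Qed.

Lemma in_tri a b c k : (a <= m)%N -> (b <= m)%N -> (c <= m)%N -> (k <= m)%N ->
  (q k \in tri a b c) = [|| k == a, k == b | k == c].
Proof.
move=> am bm cm km; rewrite in_fset3.
have e x : (x <= m)%N -> (q k == q x) = (k == x).
  by move=> xm; apply/eqP/eqP => [/q_inj|->] //; apply.
by rewrite !e.
Qed.

Lemma is_tri_ccw i j t : is_tri i j t -> ccw_triangle t.
Proof. by move=> [a [b [c [_ [-> h]]]]]; exists (q a), (q b), (q c). Qed.

Lemma is_tri_nondegenerate i j t : is_tri i j t -> nondegenerate_triangle t.
Proof. by move=> /is_tri_ccw/nondegenerate_ccw. Qed.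

Lemma is_tri_points i j t : is_tri i j t -> [set` t] `<=` points i j.
Proof.
move=> [a [b [c [[ia ab bc cj] [-> _]]]]] x /=; rewrite in_fset3.
by move=> /or3P[]/eqP->; [exists a|exists b|exists c] => //; lia.
Qed.

Lemma is_tri_hull i j t : is_tri i j t -> hull t `<=` convex_hull (points i j).
Proof. by move=> /is_tri_points ij; apply: hull_mono. Qed.

Lemma is_tri_widen i j i' j' t : (i' <= i)%N -> (j <= j')%N ->
  is_tri i j t -> is_tri i' j' t.
Proof.
move=> ii' jj' [a [b [c [[ia ab bc cj] ht]]]]; exists a, b, c; split=> //.
by split; lia.
Qed.

Lemma sub_points i j i' j' : (i' <= i)%N -> (j <= j')%N -> points i j `<=` points i' j'.
Proof. by move=> ii' jj' x [k /andP[ik kj] ->]; exists k => //; lia. Qed.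

Lemma ccw_chain_sub i j i' j' : (i <= i')%N -> (j' <= j)%N ->
  ccw_chain i j -> ccw_chain i' j'.
Proof. by move=> ii' jj' h a b c *; apply: h => //; lia. Qed.

Lemma convex_chain_sub i j i' j' : (i <= i')%N -> (j' <= j)%N ->
  convex_chain i j -> convex_chain i' j'.
Proof.
move=> ii' jj' [h h']; split; first exact: ccw_chain_sub h.
by move=> a b c *; apply: h' => //; lia.
Qed.

Lemma ccw_chain_base i j : (i <= j)%N -> ccw_chain i j ->
  forall p, convex_hull (points i j) p -> 0 <= orient (q j) (q i) p.
Proof.
move=> ij cc; apply: affine_hull; first exact: affine_orient.
by move=> _ [a /andP[ia aj] ->]; rewrite orient_rot; apply: cc.
Qed.

(** An inner [q k] on the base line lies strictly between [q i] and [q j]. For any [q x], the signs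
    of its triple with [q k] and of the triple [i, x, j] then bound the same area from both sides by
    0, so the chain would be flat, against [a, b, c]. *)
Lemma convex_chain_base i j : (j <= m)%N -> convex_chain i j ->
  forall a b c, (i <= a)%N -> (a < b)%N -> (b < c)%N -> (c <= j)%N -> 0 < orientq a b c ->
  forall k, (i < k)%N -> (k < j)%N -> 0 < orientq i k j.
Proof.
move=> jm [cc seg] a b c ia ab bc cj abc k ik kj.
rewrite lt_neqAle cc ?(ltnW ik) ?(ltnW kj) // andbT eq_sym; apply/eqP => e0.
have /segmentP[t /andP[t0 t1] et] := seg _ _ _ (leqnn i) ik kj (leqnn j) e0.
have ij : q i != q j by apply: q_neq => //; lia.
have tn0 : t != 0.
  by apply/eqP => tz; have := q_neq ik (ltnW (leq_trans kj jm)); rewrite et tz mix0 eqxx.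
have tn1 : t != 1.
  by apply/eqP => tz; have := q_neq kj jm; rewrite et tz mix1 eqxx.
have t0' : 0 < t by rewrite lt_neqAle eq_sym tn0.
have t1' : t < 1 by rewrite lt_neqAle tn1.
have flat x : (i <= x <= j)%N -> orientq i j x = 0.
  move=> /andP[ix xj]; have oxj : orientq i j x = - orientq i x j by rewrite orient_swapr.
  have ge := cc i x j (leqnn i) ix xj (leqnn j).
  have [xk|kx] := leqP x k.
    have h := cc x k j ix xk (ltnW kj) (leqnn j).
    have e : orientq x k j = (1 - t) * orientq i j x by rewrite et /orient !mixE; ring.
    by apply/eqP; rewrite oxj oppr_eq0 eq_le ge andbT; move: h;
      rewrite e oxj pmulr_rge0 ?subr_gt0 // oppr_ge0.
  have h := cc i k x (leqnn i) (ltnW ik) (ltnW kx) xj.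
  have e : orientq i k x = t * orientq i j x by rewrite et /orient !mixE; ring.
  by apply/eqP; rewrite oxj oppr_eq0 eq_le ge andbT; move: h;
    rewrite e oxj pmulr_rge0 // oppr_ge0.
by move: abc; rewrite (collinear_trans ij (flat a _) (flat b _) (flat c _)) ?ltxx //; lia.
Qed.

Lemma is_tri_base i j t : (j <= m)%N -> convex_chain i j -> is_tri i j t ->
  forall k, (i < k)%N -> (k < j)%N -> 0 < orientq i k j.
Proof.
by move=> jm cij [a [b [c [[ia ab bc cj] [_ h]]]]]; apply: convex_chain_base h.
Qed.

Section Split.
Variables i k j : nat.
Hypotheses (ik : (i < k)%N) (kj : (k < j)%N) (jm : (j <= m)%N).
Hypotheses (ccw_ij : ccw_chain i j) (ikj : 0 < orientq i k j).
Hypotheses (cik : convex_chain i k) (ckj : convex_chain k j).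

Let ij : (i < j)%N. Proof. exact: ltn_trans kj. Qed.

(** The line through [q i, q k] separates the left subchain from the other two pieces, and the line
    through [q k, q j] separates the right one; the next two lemmas give the signs on those
    pieces. *)
Lemma left_ge0 p : convex_hull (points i k) p ->
  0 <= orient (q k) (q j) p /\ 0 <= orient (q k) (q i) p.
Proof.
move=> hp; split; move: p hp; apply: affine_hull; try exact: affine_orient.
  by move=> _ [a /andP[ia ak] ->]; rewrite -orient_rot; apply: ccw_ij => //; lia.
by move=> _ [a /andP[ia ak] ->]; rewrite orient_rot; apply: ccw_ij => //; lia.
Qed.

Lemma right_ge0 p : convex_hull (points k j) p ->
  0 <= orient (q i) (q k) p /\ 0 <= orient (q j) (q k) p.
Proof.
move=> hp; split; move: p hp; apply: affine_hull; try exact: affine_orient.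
  by move=> _ [a /andP[ia ak] ->]; apply: ccw_ij => //; lia.
by move=> _ [a /andP[ia ak] ->]; rewrite orient_rot; apply: ccw_ij => //; lia.
Qed.

Lemma middle_ge0 p : hull (tri i k j) p ->
  [/\ 0 <= orient (q i) (q k) p, 0 <= orient (q k) (q j) p & 0 <= orient (q j) (q i) p].
Proof.
move=> hp; split; move: p hp; apply: affine_hull; try exact: affine_orient;
  move=> x /=; rewrite in_fset3 => /or3P[]/eqP->;
  rewrite ?orient_aba ?orient_abb ?lexx // ?(ltW ikj) //.
  by rewrite -orient_rot ltW.
by rewrite orient_rot ltW.
Qed.

Lemma left_right_meet p : convex_hull (points i k) p -> convex_hull (points k j) p ->
  p = q k.
Proof.
move=> /left_ge0[h1 h2] /right_ge0[h3 h4].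
have e1 : orient (q i) (q k) p = 0 by move: h2; rewrite orient_swap; lra.
have e2 : orient (q k) (q j) p = 0 by move: h4; rewrite orient_swap; lra.
have := orient_sum (q i) (q k) (q j) p; rewrite e1 e2 !add0r => e3.
have n : orientq i k j != 0 by rewrite gt_eqF.
by apply: planeP; apply: (mulfI n); rewrite barycentric e1 e2 e3; ring.
Qed.

Lemma points_split : points i j = points i k `|` points k j.
Proof.
apply/seteqP; split=> x.
  move=> [a /andP[ia aj] ->]; have [ak|ka] := leqP a k.
    by left; exists a => //; rewrite ia.
  by right; exists a => //; rewrite aj ltnW.
by case; apply: sub_points => //; exact: ltnW.
Qed.

(** [hull_cut] along the line through [q i] and [q k]; the last side [q k.-1, q k] of the subchain
    and the base [q j, q i] are the supporting lines that confine the crossing point. *)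
Lemma hull_left p : convex_hull (points i j) p -> 0 < orient (q k) (q i) p ->
  convex_hull (points i k) p.
Proof.
move=> hp kip.
(* If the subchain were flat, no point of the hull would lie strictly beyond this line. *)
have [k1 k1k ik1k] : exists2 k1, (i < k1 < k)%N & 0 < orientq i k1 k.
  apply: contrapT => flat; have : orient (q k) (q i) p <= 0.
    move: p hp {kip}; apply: affine_hull_le; first exact: affine_orient.
    move=> _ [a /andP[ia aj] ->]; have [ka|ak] := leqP k a.
      by rewrite orient_swap oppr_le0; apply: ccw_ij => //; lia.
    have [->|ne] := eqVneq a i; first by rewrite orient_abb.
    by rewrite leNgt; apply/negP => h; apply: flat; exists a; [lia|rewrite -orient_rot].
  by rewrite leNgt kip.
have st := convex_chain_base (leq_trans (ltnW kj) jm) cik (leqnn i) _ _ (leqnn k) ik1k.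
have {}st : forall x, (i < x)%N -> (x < k)%N -> 0 < orientq i x k by apply: st; lia.
have kk : (k.-1 < k)%N by lia.
have ik' : (i < k.-1)%N by lia.
apply: (@hull_cut _ (orient (q k) (q i)) (orient (q k.-1) (q k)) (orient (q j) (q i))
  _ (points k j) (q i) (q k)); try exact: affine_orient.
- by exists i => //; lia.
- by exists k => //; lia.
- by exists k => //; lia.
- by apply: q_neq => //; lia.
- by move=> z; rewrite orient_swap; lra.
- move=> _ [a /andP[ka aj] ->]; rewrite orient_swap oppr_le0; apply: ccw_ij => //; lia.
- move=> z /=; rewrite -[_ \/ _]/((points i k `|` points k j) z) -points_split.
  move=> [a /andP[ia aj] ->]; have [ka|ak] := leqP k a; first by apply: ccw_ij => //; lia.
  by rewrite -orient_rot; apply: ccw_ij => //; lia.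
- by rewrite orient_abb.
- by rewrite -orient_rot st.
- move=> z /=; rewrite -[_ \/ _]/((points i k `|` points k j) z) -points_split.
  move=> [a /andP[ia aj] ->].
  by rewrite orient_rot; apply: ccw_ij => //; lia.
- by rewrite orient_abb.
- by rewrite orient_rot.
- by rewrite -points_split.
- by [].
Qed.

(** Mirror image of [hull_left]: the supporting lines are the first side [q k, q k.+1] and the
    base. *)
Lemma hull_right p : convex_hull (points i j) p -> 0 < orient (q j) (q k) p ->
  convex_hull (points k j) p.
Proof.
move=> hp kip.
have [k1 k1k ik1k] : exists2 k1, (k < k1 < j)%N & 0 < orientq k k1 j.
  apply: contrapT => flat; have : orient (q j) (q k) p <= 0.
    move: p hp {kip}; apply: affine_hull_le; first exact: affine_orient.
    move=> _ [a /andP[ia aj] ->]; have [ka|ak] := leqP a k.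
      by rewrite orient_swap oppr_le0 -orient_rot; apply: ccw_ij => //; lia.
    have [->|ne] := eqVneq a j; first by rewrite orient_aba.
    by rewrite leNgt; apply/negP => h; apply: flat; exists a; [lia|rewrite -orient_rot].
  by rewrite leNgt kip.
have st := convex_chain_base jm ckj (leqnn k) _ _ (leqnn j) ik1k.
have {}st : forall x, (k < x)%N -> (x < j)%N -> 0 < orientq k x j by apply: st; lia.
have ik' : (k.+1 < j)%N by lia.
apply: (@hull_cut _ (orient (q j) (q k)) (orient (q k) (q k.+1)) (orient (q j) (q i))
  _ (points i k) (q j) (q k)); try exact: affine_orient.
- by exists j => //; lia.
- by exists k => //; lia.
- by exists k => //; lia.
- by rewrite eq_sym; apply: q_neq.
- by [].
- move=> _ [a /andP[ka aj] ->]; rewrite orient_swap oppr_le0 -orient_rot.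
  by apply: ccw_ij => //; lia.
- move=> z /=; rewrite -[_ \/ _]/((points k j `|` points i k) z) setUC -points_split.
  move=> [a /andP[ia aj] ->]; have [ka|ak] := leqP a k.
    by rewrite -orient_rot; apply: ccw_ij => //; lia.
  by apply: ccw_ij => //; lia.
- by rewrite orient_aba.
- exact: st.
- move=> z /=; rewrite -[_ \/ _]/((points k j `|` points i k) z) setUC -points_split.
  move=> [a /andP[ia aj] ->].
  by rewrite orient_rot; apply: ccw_ij => //; lia.
- by rewrite orient_aba.
- by rewrite orient_rot.
- by rewrite setUC -points_split.
- by [].
Qed.

End Split.

End Chains.

(** The intersection lies on the line [g = 0], hence in the face of [s] there, which is spanned by
    those of [u], [v] that are vertices of [s]; their number decides among edge, vertex and empty
    set. *)
Lemma meet_properly_line (R : realType) (s t : {fset plane R}) u v (g : plane R -> R) :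
  affine g -> (forall x, x \in s -> 0 <= g x) -> (forall x, hull t x -> g x <= 0) ->
  (forall x, x \in s -> g x = 0 -> x = u \/ x = v) -> u != v -> u \in t -> v \in t ->
  meet_properly s t.
Proof.
move=> ag gs gt suv uv ut vt.
have face x : hull s x -> hull t x -> convex_hull ([set` s] `&` [set y | g y = 0]) x.
  move=> sx tx; apply: hull_face => //.
  by apply/eqP; rewrite eq_le gt //=; apply: (affine_hull ag) sx.
have [su|us] := boolP (u \in s); have [sv|vs] := boolP (v \in s).
- apply: Or33; exists u, v; split=> //; rewrite ?inE ?su ?sv //.
  apply/seteqP; split=> [x [sx tx]|x xuv].
    by move: (face x sx tx); apply: hull_mono => y [/= sy gy]; apply: suv.
  by split; [exact: (segment_hull su sv)|exact: (segment_hull ut vt)].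
- apply: Or32; exists u; rewrite ?inE ?su //; apply/seteqP; split=> [x [sx tx]|_ ->].
    rewrite -hull_set1; move: (face x sx tx); apply: hull_mono => y [/= sy gy].
    by have [//|yv] := suv y sy gy; rewrite -yv sy in vs.
  by split; apply: vertex_hull.
- apply: Or32; exists v; rewrite ?inE ?sv //; apply/seteqP; split=> [x [sx tx]|_ ->].
    rewrite -hull_set1; move: (face x sx tx); apply: hull_mono => y [/= sy gy].
    by have [yv|//] := suv y sy gy; rewrite -yv sy in us.
  by split; apply: vertex_hull.
- apply: Or31; rewrite -subset0 => x [sx tx].
  rewrite -hull_set0; move: (face x sx tx); apply: hull_mono => y [/= sy gy].
  have [yv|yv] := suv y sy gy; first by rewrite -yv sy in us.
  by rewrite -yv sy in vs.
Qed.

(** * Gluing and cutting triangulations along a base triangle *)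

Section MergeSplit.
Variables (R : realType) (q : nat -> plane R) (m : nat).
Implicit Types (i j k a b c r : nat) (p : plane R) (t s : {fset plane R}).
Implicit Types (T : {fset {fset plane R}}).

Hypothesis q_inj : forall a b, (a <= m)%N -> (b <= m)%N -> q a = q b -> a = b.

Local Notation orientq a b c := (orient (q a) (q b) (q c)).
Local Notation tri := (tri q).
Local Notation points := (points q).
Local Notation is_tri := (is_tri q).

Section Merge.
Variables i k j : nat.
Hypotheses (ik : (i < k)%N) (kj : (k < j)%N) (jm : (j <= m)%N).
Hypotheses (ccw_ij : ccw_chain q i j) (ikj : 0 < orientq i k j).
Hypotheses (cik : convex_chain q i k) (ckj : convex_chain q k j).

Let ij : (i < j)%N. Proof. exact: ltn_trans kj. Qed.
Let km : (k <= m)%N. Proof. exact: leq_trans (ltnW kj) jm. Qed.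

Lemma is_tri_middle : is_tri i j (tri i k j).
Proof. by exists i, k, j. Qed.

Lemma meet_left_middle t : is_tri i k t -> meet_properly t (tri i k j).
Proof.
move=> ht; have base := is_tri_base q_inj km cik ht.
apply: (@meet_properly_line _ _ _ (q i) (q k) (orient (q k) (q i))).
- exact: affine_orient.
- move=> x /(is_tri_points ht) px.
  by have [] := left_ge0 ik kj jm ccw_ij ikj (sub_hull px).
- by move=> x /(middle_ge0 ikj)[h _ _]; rewrite orient_swap oppr_le0.
- move=> x /(is_tri_points ht)[a /andP[ia ak] ->].
  have [->|ai] := eqVneq a i; first by left.
  have [->|ak'] := eqVneq a k; first by right.
  by move=> h; have := base a; rewrite orient_rot orient_rot h ltxx; lia.
- exact: (q_neq q_inj).
- by rewrite in_fset3 eqxx.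
- by rewrite in_fset3 eqxx orbT.
Qed.

Lemma meet_right_middle t : is_tri k j t -> meet_properly t (tri i k j).
Proof.
move=> ht; have base := is_tri_base q_inj jm ckj ht.
apply: (@meet_properly_line _ _ _ (q k) (q j) (orient (q j) (q k))).
- exact: affine_orient.
- move=> x /(is_tri_points ht) px.
  by have [] := right_ge0 ik kj jm ccw_ij ikj (sub_hull px).
- by move=> x /(middle_ge0 ikj)[_ h _]; rewrite orient_swap oppr_le0.
- move=> x /(is_tri_points ht)[a /andP[ia ak] ->].
  have [->|ai] := eqVneq a k; first by left.
  have [->|ak'] := eqVneq a j; first by right.
  by move=> h; have := base a; rewrite orient_rot orient_rot h ltxx; lia.
- exact: (q_neq q_inj).
- by rewrite in_fset3 eqxx orbT.
- by rewrite in_fset3 eqxx !orbT.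
Qed.

Lemma chain_triangulation_merge T1 T2 :
  chain_triangulation q i k T1 -> chain_triangulation q k j T2 ->
  chain_triangulation q i j (tri i k j |` (T1 `|` T2))%fset.
Proof.
move=> [t1 c1 m1 u1 e1] [t2 c2 m2 u2 e2].
have inT t : t \in (tri i k j |` (T1 `|` T2))%fset ->
    [\/ t = tri i k j, t \in T1 | t \in T2].
  by rewrite !inE => /or3P[/eqP|h|h]; [apply: Or31|apply: Or32|apply: Or33].
have T1T t : t \in T1 -> t \in (tri i k j |` (T1 `|` T2))%fset.
  by rewrite !inE => ->; rewrite orbT.
have T2T t : t \in T2 -> t \in (tri i k j |` (T1 `|` T2))%fset.
  by rewrite !inE => ->; rewrite !orbT.
(* Two triangles from different sides can share only [q k], and the last clause for each side makes
   it a vertex of both. *)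
have m12 s t : s \in T1 -> t \in T2 -> meet_properly s t.
  move=> sT tT; have [e|/set0P[p [sp tp]]] := eqVneq (hull s `&` hull t) set0.
    exact: Or31.
  have meet x : hull s x -> hull t x -> x = q k.
    move=> sx tx; apply: (left_right_meet ik kj jm ccw_ij ikj).
      exact: (is_tri_hull (t1 _ sT)).
    exact: (is_tri_hull (t2 _ tT)).
  have pk := meet p sp tp; rewrite pk in sp tp.
  apply: Or32; exists (q k).
    by rewrite inE e1 ?e2 // leqnn ?andbT ltnW.
  by apply/seteqP; split=> [x [sx tx]|_ ->]; first exact: meet.
split.
- move=> t /inT[->|/t1|/t2]; first exact: is_tri_middle.
    by apply: is_tri_widen => //; exact: ltnW.
  by apply: is_tri_widen => //; exact: ltnW.
- move=> p hp _; have [h1|h1] := ltP 0 (orient (q k) (q i) p).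
    have [t tT tp] := c1 p (hull_left q_inj ik kj jm ccw_ij ikj cik hp h1) h1.
    by exists t => //; apply: T1T.
  have [h2|h2] := ltP 0 (orient (q j) (q k) p).
    have [t tT tp] := c2 p (hull_right q_inj ik kj jm ccw_ij ikj ckj hp h2) h2.
    by exists t => //; apply: T2T.
  exists (tri i k j); first by rewrite !inE eqxx.
  apply: (@triangle_hull _ _ (q i) (q k) (q j)) => //=; rewrite ?in_fset3 ?eqxx ?orbT //.
  + by rewrite orient_swap oppr_ge0.
  + by rewrite orient_swap oppr_ge0.
  + exact: ccw_chain_base (ltnW ij) ccw_ij _ hp.
- move=> s t /inT[->|sT|sT] /inT[->|tT|tT] st; first by rewrite eqxx in st.
  + by apply: meet_properlyC; apply: meet_left_middle; apply: t1.
  + by apply: meet_properlyC; apply: meet_right_middle; apply: t2.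
  + by apply: meet_left_middle; apply: t1.
  + exact: m1.
  + exact: m12.
  + by apply: meet_right_middle; apply: t2.
  + by apply: meet_properlyC; apply: m12.
  + exact: m2.
- move=> a ia aj; have [ak|ka|->] := ltngtP a k.
  + by have [t tT qa] := u1 a ia ak; exists t => //; apply: T1T.
  + by have [t tT qa] := u2 a ka aj; exists t => //; apply: T2T.
  + by exists (tri i k j); rewrite ?inE ?eqxx // orbT.
- move=> t a /inT[->|tT|tT] /andP[ia aj] hta.
  + have [e|ai] := eqVneq a i; first by rewrite e in_fset3 eqxx.
    have [e|aj'] := eqVneq a j; first by rewrite e in_fset3 eqxx !orbT.
    have [h1 h2 _] := middle_ge0 ikj hta; rewrite in_fset3.
    have [ak|ka|->] := ltngtP a k; last by rewrite eqxx orbT.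
      have ia' : (i < a)%N by lia.
      (* A triangle using [q a] shows that the left chain is not flat, so [q a] is strictly beyond
         the line [q i, q k] and outside the middle triangle. *)
      have [s /t1 hs _] := u1 a ia' ak.
      have := is_tri_base q_inj km cik hs ia' ak.
      by move: h1; rewrite orient_swapr oppr_ge0 leNgt => /negbTE->.
    have aj2 : (a < j)%N by lia.
    have [s /t2 hs _] := u2 a ka aj2.
    have := is_tri_base q_inj jm ckj hs ka aj2.
    by move: h2; rewrite orient_swapr oppr_ge0 leNgt => /negbTE->.
  + have [ak|ka] := leqP a k; first by apply: e1; rewrite ?ia.
    suff e : q a = q k by rewrite e; apply: e1; rewrite ?leqnn ?andbT -?e // ltnW.
    apply: (left_right_meet ik kj jm ccw_ij ikj).
      exact: (is_tri_hull (t1 _ tT)).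
    by apply: sub_hull; exists a => //; rewrite (ltnW ka).
  + have [ka|ak] := leqP k a; first by apply: e2; rewrite ?ka.
    suff e : q a = q k by rewrite e; apply: e2; rewrite ?leqnn -?e //= ltnW.
    apply: (left_right_meet ik kj jm ccw_ij ikj).
      by apply: sub_hull; exists a => //; rewrite ia ltnW.
    exact: (is_tri_hull (t2 _ tT)).
Qed.

(** Covering is postulated only strictly off the base line. Moving [p] towards the apex [q k] enters
    that region, and closedness of the triangles gives [p] itself. *)
Lemma chain_cover T : chain_triangulation q i j T ->
  forall p, convex_hull (points i j) p -> exists2 t, t \in T & hull t p.
Proof.
move=> [tt c _ _ _] p hp; apply: (@triangles_cover_limit _ _ _ (q k)).
  by move=> t /tt /is_tri_ccw.
move=> r /andP[r0 r1]; apply: c.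
  apply: hull_mix => //; first by rewrite (ltW r0).
  by apply: sub_hull; exists k => //; rewrite (ltnW ik) (ltnW kj).
have p0 := ccw_chain_base (ltnW ij) ccw_ij hp.
rewrite affine_orient; apply: ltr_wpDl; first by rewrite mulr_ge0 // subr_ge0.
by rewrite mulr_gt0 // orient_rot.
Qed.

Section Decompose.
Variable T : {fset {fset plane R}}.
Hypothesis chT : chain_triangulation q i j T.
Hypothesis Tm : tri i k j \in T.
Hypothesis sides : forall t, t \in T -> t != tri i k j -> is_tri i k t \/ is_tri k j t.

Definition left_part := [fset t in T | `[< is_tri i k t >]]%fset.
Definition right_part := [fset t in T | `[< is_tri k j t >]]%fset.

Lemma in_left t : t \in left_part -> t \in T /\ is_tri i k t.
Proof. by rewrite !inE /= => /andP[tT /asboolP]. Qed.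

Lemma in_right t : t \in right_part -> t \in T /\ is_tri k j t.
Proof. by rewrite !inE /= => /andP[tT /asboolP]. Qed.

Lemma chain_split_left : chain_triangulation q i k left_part.
Proof.
case: (chT) => tt _ mt u e; split.
- by move=> t /in_left[].
- move=> p hp h; have [t tT tp] : exists2 t, t \in T & hull t p.
    apply: (chain_cover chT).
    by apply: hull_mono hp; apply: sub_points => //; exact: ltnW.
  have bad : 0 <= orient (q i) (q k) p -> False.
    by move: h; rewrite orient_swap oppr_gt0 ltNge => /negP.
  exists t => //; rewrite !inE tT /=; apply/asboolP.
  have [te|tn] := eqVneq t (tri i k j).
    by rewrite te in tp; have [/bad] := middle_ge0 ikj tp.
  have [//|tr] := sides tT tn.
  by have [/bad] := right_ge0 ik kj jm ccw_ij ikj (is_tri_hull tr tp).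
- by move=> s t /in_left[sT _] /in_left[tT _]; apply: mt.
- move=> a ia ak; have [t tT ta] := u a ia (ltn_trans ak kj).
  exists t => //; rewrite !inE tT /=; apply/asboolP.
  have [te|tn] := eqVneq t (tri i k j).
    by move: ta; rewrite te (in_tri q_inj); lia.
  have [//|tr] := sides tT tn; have [b /andP[kb bj] /q_inj eab] := is_tri_points tr ta.
  by move: eab; lia.
- move=> t a /in_left[tT _] /andP[ia ak]; apply: e => //.
  by rewrite ia (leq_trans ak (ltnW kj)).
Qed.

Lemma chain_split_right : chain_triangulation q k j right_part.
Proof.
case: (chT) => tt _ mt u e; split.
- by move=> t /in_right[].
- move=> p hp h; have [t tT tp] : exists2 t, t \in T & hull t p.
    apply: (chain_cover chT).
    by apply: hull_mono hp; apply: sub_points => //; exact: ltnW.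
  have bad : 0 <= orient (q k) (q j) p -> False.
    by move: h; rewrite orient_swap oppr_gt0 ltNge => /negP.
  exists t => //; rewrite !inE tT /=; apply/asboolP.
  have [te|tn] := eqVneq t (tri i k j).
    by rewrite te in tp; have [_ /bad] := middle_ge0 ikj tp.
  have [tr|//] := sides tT tn.
  by have [/bad] := left_ge0 ik kj jm ccw_ij ikj (is_tri_hull tr tp).
- by move=> s t /in_right[sT _] /in_right[tT _]; apply: mt.
- move=> a ka aj; have [t tT ta] := u a (ltn_trans ik ka) aj.
  exists t => //; rewrite !inE tT /=; apply/asboolP.
  have [te|tn] := eqVneq t (tri i k j).
    by move: ta; rewrite te (in_tri q_inj); lia.
  have [tr|//] := sides tT tn; have [b /andP[ib bk] /q_inj eab] := is_tri_points tr ta.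
  by move: eab; lia.
- move=> t a /in_right[tT _] /andP[ka aj]; apply: e => //.
  by rewrite aj (leq_trans (ltnW ik) ka).
Qed.

Lemma chain_split_union : T = (tri i k j |` (left_part `|` right_part))%fset.
Proof.
apply/fsetP => t; apply/idP/idP => [tT|].
  have [te|tn] := eqVneq t (tri i k j); first by rewrite te !inE eqxx.
  have [tr|tr] := sides tT tn.
    rewrite in_fset1U in_fsetU; apply/orP; right; apply/orP; left.
    by rewrite !inE tT; apply/asboolP.
  rewrite in_fset1U in_fsetU; apply/orP; right; apply/orP; right.
  by rewrite !inE tT; apply/asboolP.
rewrite in_fset1U in_fsetU => /predU1P[->//|/orP[/in_left[]|/in_right[]]] //.
Qed.

End Decompose.

End Merge.
End MergeSplit.

Lemma card_fset_pairs (K1 K2 K : choiceType) (f : K1 -> K2 -> K)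
    (A : {fset K1}) (B : {fset K2}) (X : {fset K}) :
  (forall x x' y y', x \in A -> x' \in A -> y \in B -> y' \in B ->
     f x y = f x' y' -> x = x' /\ y = y') ->
  (forall z, z \in X <-> exists x y, [/\ x \in A, y \in B & z = f x y]) ->
  #|` X| = (#|` A| * #|` B|)%N.
Proof.
move=> f_inj XE; rewrite -(size_allpairs f (enum_fset A) (enum_fset B)).
apply/perm_size/uniq_perm; first exact: fset_uniq.
  apply: allpairs_uniq; try exact: fset_uniq.
  move=> [x y] [x' y'] /allpairsP[[u v] /= [uA vB [-> ->]]].
  move=> /allpairsP[[u' v'] /= [uA' vB' [-> ->]]] e.
  by have [-> ->] := f_inj u u' v v' uA uA' vB vB' e.
move=> z; apply/idP/allpairsP => [/XE[x [y [xA yB ->]]]|[[x y] /= [xA yB ->]]].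
  by exists (x, y).
by apply/XE; exists x, y.
Qed.

(** * Recursion for the numbers of chain triangulations *)

Section Counting.
Variables (R : realType) (q : nat -> plane R) (m : nat).
Implicit Types (i j k a b c r : nat) (p : plane R) (t s : {fset plane R}).
Implicit Types (T : {fset {fset plane R}}).

Hypothesis q_inj : forall a b, (a <= m)%N -> (b <= m)%N -> q a = q b -> a = b.

Local Notation orientq a b c := (orient (q a) (q b) (q c)).
Local Notation tri := (tri q).
Local Notation points := (points q).
Local Notation is_tri := (is_tri q).

Section Loop.
Variables i j : nat.
Hypotheses (ij : (i.+1 < j)%N) (jm : (j <= m)%N) (loop : convex_loop q i j).

Let ccw_ij : ccw_chain q i j. Proof. by case: loop. Qed.
Let ltij : (i < j)%N. Proof. exact: ltnW. Qed.

(** [q i.+1] is a vertex of a nondegenerate triangle, so the points cannot all lie on the base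
    line. *)
Lemma loop_apex T : chain_triangulation q i j T ->
  exists2 r, (i < r < j)%N & 0 < orientq i r j.
Proof.
move=> [tt _ _ u _]; have [t /tt[a [b [c [[ia ab bc cj] [_ h]]]]] _] := u i.+1 (ltnSn i) ij.
apply: contrapT => flat.
have flat' r : (i <= r <= j)%N -> orientq i j r = 0.
  move=> /andP[ir rj]; have [->|ri] := eqVneq r i; first by rewrite orient_aba.
  have [->|rj'] := eqVneq r j; first by rewrite orient_abb.
  rewrite orient_swapr; apply/eqP; rewrite oppr_eq0 eq_le ccw_ij // andbT leNgt.
  by apply/negP => h'; apply: flat; exists r => //; lia.
have qij : q i != q j by apply: (q_neq q_inj).
by move: h; rewrite (collinear_trans qij (flat' a _) (flat' b _) (flat' c _)) ?ltxx //; lia.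
Qed.

(** Take a triangle that covers the midpoint [p] of the base. Its face on the base line contains
    [p], while no chain point lies strictly between [q i] and [q j]; this forces both to be
    vertices. *)
Lemma loop_base_triangle T : chain_triangulation q i j T ->
  exists k, [/\ (i < k)%N, (k < j)%N, 0 < orientq i k j & tri i k j \in T].
Proof.
move=> chT; have [r /andP[ir rj] irj] := loop_apex chT.
have [tt _ _ _ e] := chT; have [_ _ wrap] := loop.
pose p := mix (1 / 2) (q i) (q j).
have [t tT tp] : exists2 t, t \in T & hull t p.
  apply: (chain_cover ir rj ccw_ij irj chT).
  apply: hull_mix; first by apply/andP; split; lra.
    by apply: sub_hull; exists i; rewrite // leqnn ltnW.
  by apply: sub_hull; exists j; rewrite // leqnn ltnW.
have tij := tt t tT.
pose f := orient (q j) (q i).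
have fp : f p = 0 by rewrite /f affine_orient orient_aba orient_abb; ring.
have := @hull_face _ f [set` t] (affine_orient _ _) _ p tp fp.
have f_ge0 x : [set` t] x -> 0 <= f x.
  move=> /(is_tri_points tij) px.
  exact: (ccw_chain_base (ltnW ltij) ccw_ij (sub_hull px)).
move=> /(_ f_ge0); set E := (_ `&` _) => pE.
have Eq x : E x -> exists2 a, (i <= a <= j)%N & x = q a /\ orientq i a j = 0.
  move=> [/(is_tri_points tij)[a aij ->] fa]; exists a => //; split=> //.
  by rewrite -fa /f -orient_rot.
(* Position along the base, up to scale: 0 at [q i], while the other chain points on this line lie
   at [q j] or beyond. *)
pose d (x : plane R) := (x 0 0 - q i 0 0) * (q j 0 0 - q i 0 0) +
  (x 0 1 - q i 0 1) * (q j 0 1 - q i 0 1).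
have ad : affine d by move=> s x y; rewrite /d !mixE; ring.
have di : d (q i) = 0 by rewrite /d; ring.
have dj : 0 < d (q j).
  have : q i != q j by apply: (q_neq q_inj).
  rewrite /d -!expr2 lt_neqAle addr_ge0 ?sqr_ge0 // andbT; apply: contraNneq => /esym/eqP.
  rewrite paddr_eq0 ?sqr_ge0 // !sqrf_eq0 !subr_eq0 => /andP[/eqP h0 /eqP h1].
  by apply/eqP/planeP.
have dp : d p = d (q j) / 2 by rewrite ad di; field.
have beyond a : (i < a)%N -> (a <= j)%N -> orientq i a j = 0 -> segment (q a) (q i) (q j).
  move=> ia; rewrite leq_eqVlt => /predU1P[->|aj] e0.
    by apply: sub_hull; left.
  exact: wrap irj _ _ e0.
have d_ge a : (i < a)%N -> (a <= j)%N -> orientq i a j = 0 -> d (q j) <= d (q a).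
  move=> ia aj e0; have /segmentP[s /andP[s0 s1] ej] := beyond a ia aj e0.
  have : d (q j) = (1 - s) * d (q a) by rewrite ej ad di mulr0 addr0.
  have [da|da] := leP (d (q a)) 0.
    by move=> e1; move: dj; rewrite e1 ltNge mulr_ge0_le0 // subr_ge0.
  by move=> ->; apply: ler_piMl; [exact: ltW|rewrite gerBl].
(* Without [q i] every vertex on the line would be at [q j] or beyond, past the midpoint. *)
have ti : q i \in t.
  apply: contraT => nti; have : d (q j) <= d p.
    apply: (affine_hull ad) pE => x Ex; have [a /andP[ia aj] [xa e0]] := Eq x Ex.
    rewrite xa; apply: d_ge => //; rewrite ltn_neqAle ia andbT.
    by apply: contra nti => /eqP->; case: Ex; rewrite xa.
  by rewrite dp; lra.
(* A vertex on the line beyond [q j] would, together with [q i], put [q j] into the triangle and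
   make it a vertex by the last clause; so without [q j] the face is just [q i] and misses [p]. *)
have tj : q j \in t.
  apply: contrapT => ntj; have : d p <= 0.
    apply: (affine_hull_le ad) pE => x Ex; have [a /andP[ia aj] [xa e0]] := Eq x Ex.
    have [ai|ai] := eqVneq a i; first by rewrite xa ai di.
    case: ntj; apply: e => //; first by rewrite leqnn ltnW.
    have ta : q a \in t by case: Ex; rewrite xa.
    by apply: (segment_hull ta ti); apply: beyond => //; rewrite ltn_neqAle eq_sym ai.
  by rewrite dp; lra.
have [a [b [c [[ia ab bc cj] [te h]]]]] := tij.
move: ti tj; rewrite te !(in_tri q_inj); [|lia..] => ti tj.
have ea : a = i by lia.
have ec : c = j by lia.
by exists b; rewrite ea ec in ab bc h te; split=> //; rewrite -te.
Qed.

Variable k : nat.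
Hypotheses (ik : (i < k)%N) (kj : (k < j)%N) (ikj : 0 < orientq i k j).

Let cik : convex_chain q i k. Proof. by case: loop => _ h _; case: (h k ik kj ikj). Qed.
Let ckj : convex_chain q k j. Proof. by case: loop => _ h _; case: (h k ik kj ikj). Qed.

(** A triangle with indices both below and above [k] has an edge crossing [q i q k] or [q k q j],
    unless it is the base triangle itself. *)
Lemma loop_sides T : chain_triangulation q i j T -> tri i k j \in T ->
  forall t, t \in T -> t != tri i k j -> is_tri i k t \/ is_tri k j t.
Proof.
move=> [tt _ mt _ e] Tm t tT tn.
have nm := is_tri_nondegenerate (tt _ Tm); have nt := is_tri_nondegenerate (tt _ tT).
have mm : meet_properly (tri i k j) t by apply: mt => //; rewrite eq_sym.
have [mi mk mj] : [/\ q i \in tri i k j, q k \in tri i k j & q j \in tri i k j].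
  by rewrite !in_fset3 !eqxx !orbT.
have neq a b : (a < b)%N -> (b <= m)%N -> q a != q b by exact: (q_neq q_inj).
have cross_left x y : (i < x)%N -> (x < k)%N -> (k < y)%N -> (y <= j)%N ->
    q x \in t -> q y \in t -> False.
  move=> ix xk ky yj tx ty.
  have [z z1 z2] : exists2 z, segment (q i) (q k) z & segment (q x) (q y) z.
    have h1 := ccw_ij (leqnn i) (ltnW ix) (ltnW xk) (ltnW kj).
    have h2 := ccw_ij (leqnn i) (ltnW ik) (ltnW ky) yj.
    (* A [q x] on the segment [q i q k] is its own crossing point; the strict inequality needed by
       [segments_cross] may then fail. *)
    have [h0|h0] := eqVneq (orientq i x k) 0.
      exists (q x); first exact: (cik.2 i x k).
      by apply: sub_hull; left.
    apply: segments_cross => //.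
    - exact: (ccw_ij (leqnn i) (ltnW ix) (ltnW (ltn_trans xk ky)) yj).
    - exact: (ccw_ij (ltnW ix) (ltnW xk) (ltnW ky) yj).
    - by apply: ltr_wpDr => //; rewrite lt_neqAle eq_sym h0.
  have ym := leq_trans yj jm; have km := leq_trans (ltnW ky) ym.
  apply: (meet_properly_no_crossing nm nt mm mi mk tx ty _ _ _ _ _ _ z1 z2).
  - exact: neq ik km.
  - exact: neq (ltn_trans xk ky) ym.
  - exact: neq ix (leq_trans (ltnW xk) km).
  - exact: neq (ltn_trans ik ky) ym.
  - by rewrite eq_sym; exact: neq xk km.
  - exact: neq ky ym.
have cross_right x y : (i <= x)%N -> (x < k)%N -> (k < y)%N -> (y < j)%N ->
    q x \in t -> q y \in t -> False.
  move=> ix xk ky yj tx ty.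
  have [z z1 z2] : exists2 z, segment (q x) (q y) z & segment (q k) (q j) z.
    have h1 := ccw_ij ix (ltnW xk) (ltnW ky) (ltnW yj).
    have h2 := ccw_ij ix (leq_trans (ltnW xk) (ltnW ky)) (ltnW yj) (leqnn j).
    have h3 := ccw_ij ix (ltnW xk) (ltnW kj) (leqnn j).
    have [h0|h0] := eqVneq (orientq k y j) 0.
      exists (q y); last exact: (ckj.2 k y j).
      by apply: sub_hull; right.
    have h4 : 0 < orientq k y j.
      by rewrite lt_neqAle eq_sym h0; exact: (ccw_ij (ltnW ik) (ltnW ky) (ltnW yj) (leqnn j)).
    apply: segments_cross => //; first exact: ltW.
    by rewrite orient_area; apply: ltr_wpDl.
  have ym := leq_trans (ltnW yj) jm; have km := leq_trans (ltnW ky) ym.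
  apply: (meet_properly_no_crossing nm nt mm mk mj tx ty _ _ _ _ _ _ z2 z1).
  - exact: neq kj jm.
  - exact: neq (ltn_trans xk ky) ym.
  - by rewrite eq_sym; exact: neq xk km.
  - exact: neq ky ym.
  - by rewrite eq_sym; exact: neq (ltn_trans xk kj) jm.
  - by rewrite eq_sym; exact: neq yj jm.
have [a [b [c [[ia ab bc cj] [te h]]]]] := tt _ tT.
have [ta tb tc] : [/\ q a \in t, q b \in t & q c \in t].
  by rewrite te !in_fset3 !eqxx !orbT.
have [ck|kc] := leqP c k; first by left; exists a, b, c.
have [ka|ak] := leqP k a; first by right; exists a, b, c.
have [ai|ai] := eqVneq a i; last first.
  by case: (cross_left a c) => //; rewrite ltn_neqAle eq_sym ai.
have [ej|ncj] := eqVneq c j; last first.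
  by case: (cross_right a c) => //; rewrite ltn_neqAle ncj.
rewrite ai in ab h te ta; rewrite ej in bc h te tc.
have [bk|kb|bk] := ltngtP b k.
- by case: (cross_left b j) => //.
- by case: (cross_right i b).
- by rewrite te bk eqxx in tn.
Qed.

Lemma loop_base_unique T k' : chain_triangulation q i j T -> tri i k j \in T ->
  (i < k')%N -> (k' < j)%N -> tri i k' j \in T -> k' = k.
Proof.
move=> chT Tm ik' kj' Tm'; apply: contrapT => kk'.
have [|tr|tr] := loop_sides chT Tm Tm'.
- apply/eqP => et; have : q k' \in tri i k j by rewrite -et in_fset3 eqxx orbT.
  by rewrite (in_tri q_inj); lia.
- have qj : q j \in tri i k' j by rewrite in_fset3 eqxx !orbT.
  by have [b bik /q_inj] := is_tri_points tr qj; lia.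
- have qi : q i \in tri i k' j by rewrite in_fset3 eqxx.
  by have [b bik /q_inj] := is_tri_points tr qi; lia.
Qed.

End Loop.

Variable C : {fset plane R}.
Hypothesis qC : forall a, (a <= m)%N -> q a \in C.

Definition chain_triangulations i j :=
  [fset T in fpowerset (fpowerset C) | `[< chain_triangulation q i j T >]]%fset.

Lemma in_chain_triangulations i j T : (j <= m)%N ->
  T \in chain_triangulations i j <-> chain_triangulation q i j T.
Proof.
move=> jm; rewrite !inE /=; split=> [/andP[_ /asboolP]//|chT].
apply/andP; split; last exact/asboolP.
case: chT => tt _ _ _ _; rewrite fpowersetE; apply/fsubsetP => t /tt tij.
rewrite fpowersetE; apply/fsubsetP => x /(is_tri_points tij)[a /andP[_ aj] ->].
exact/qC/(leq_trans aj).
Qed.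

Lemma card_chain_triangulations_edge i : (i < m)%N -> #|` chain_triangulations i i.+1| = 1%N.
Proof.
move=> im; rewrite (_ : chain_triangulations _ _ = [fset fset0]%fset) ?cardfs1 //.
apply/fsetP => T; rewrite in_fset1; apply/idP/eqP => [/in_chain_triangulations|->].
  move=> /(_ im)[tt _ _ _ _]; apply/fsetP => t; rewrite in_fset0; apply/negP => /tt.
  by move=> [a [b [c [[ia ab bc cj] _]]]]; lia.
apply/in_chain_triangulations => //; split=> //; last by move=> k; lia.
move=> p hp h; have : orient (q i.+1) (q i) p <= 0.
  move: p hp {h}; apply: affine_hull_le; first exact: affine_orient.
  move=> _ [a /andP[ia ai] ->]; have [->|->] : a = i \/ a = i.+1 by lia.
    by rewrite orient_abb.
  by rewrite orient_aba.
by rewrite leNgt h.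
Qed.

(** Gluing is injective: no triangle belongs to both subchains and the base triangle to neither, so
    both parts can be read off the union. *)
Lemma card_chain_triangulations_base i k j : (i.+1 < j)%N -> (j <= m)%N ->
  convex_loop q i j -> (i < k)%N -> (k < j)%N -> 0 < orientq i k j ->
  #|` [fset T in chain_triangulations i j | tri i k j \in T]%fset| =
  (#|` chain_triangulations i k| * #|` chain_triangulations k j|)%N.
Proof.
move=> ij jm loop ik kj ikj; have km : (k <= m)%N by rewrite (leq_trans (ltnW kj)).
have [ccw_ij /(_ k ik kj ikj)[cik ckj] _] := loop.
have disj t : is_tri i k t -> is_tri k j t -> False.
  move=> t1 t2; have [a [b [c [[ia ab bc ck] [te _]]]]] := t1.
  have ta : q a \in t by rewrite te in_fset3 eqxx.
  by have [x /andP[kx xj] /q_inj] := is_tri_points t2 ta; lia.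
have mid1 : ~ is_tri i k (tri i k j).
  move=> tr; have qj : q j \in tri i k j by rewrite in_fset3 eqxx !orbT.
  by have [b bik /q_inj] := is_tri_points tr qj; lia.
have mid2 : ~ is_tri k j (tri i k j).
  move=> tr; have qi : q i \in tri i k j by rewrite in_fset3 eqxx.
  by have [b bik /q_inj] := is_tri_points tr qi; lia.
pose f (T1 T2 : {fset {fset plane R}}) := (tri i k j |` (T1 `|` T2))%fset.
have leftE T1 T2 : chain_triangulation q i k T1 -> chain_triangulation q k j T2 ->
    T1 = left_part q i k (f T1 T2) /\ T2 = right_part q k j (f T1 T2).
  move=> [t1 _ _ _ _] [t2 _ _ _ _]; split; apply/fsetP => t; rewrite !inE /=.
    apply/idP/andP => [tT|[/or3P[/eqP->|//|/t2 h] /asboolP h']].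
    - by rewrite tT orbT; split=> //; apply/asboolP; exact: t1.
    - by case: mid1.
    - by case: (disj t).
  apply/idP/andP => [tT|[/or3P[/eqP->|/t1 h|//] /asboolP h']].
  - by rewrite tT !orbT; split=> //; apply/asboolP; exact: t2.
  - by case: mid2.
  - by case: (disj t).
apply: (card_fset_pairs (f := f)).
  move=> T1 T1' T2 T2' /(in_chain_triangulations _ _ km) h1
    /(in_chain_triangulations _ _ km) h1' /(in_chain_triangulations _ _ jm) h2
    /(in_chain_triangulations _ _ jm) h2' e.
  have [e1 e2] := leftE _ _ h1 h2; have [e1' e2'] := leftE _ _ h1' h2'.
  by split; [rewrite e1 e -e1'|rewrite e2 e -e2'].
have XE T : (T \in [fset T in chain_triangulations i j | tri i k j \in T]%fset) =
    (T \in chain_triangulations i j) && (tri i k j \in T).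
  by rewrite in_fset /= [LHS]inE.
move=> T; rewrite XE; split.
  move=> /andP[/(in_chain_triangulations _ _ jm) chT Tm].
  have sides := loop_sides jm loop ik kj ikj chT Tm.
  exists (left_part q i k T), (right_part q k j T); split.
  - apply/(in_chain_triangulations _ _ km).
    exact: (chain_split_left q_inj ik kj jm ccw_ij ikj chT Tm sides).
  - apply/(in_chain_triangulations _ _ jm).
    exact: (chain_split_right q_inj ik kj jm ccw_ij ikj chT Tm sides).
  - exact: (chain_split_union Tm sides).
move=> [T1 [T2 [/(in_chain_triangulations _ _ km) h1 /(in_chain_triangulations _ _ jm) h2 ->]]].
apply/andP; split; last by rewrite !inE eqxx.
apply/(in_chain_triangulations _ _ jm).
exact: (chain_triangulation_merge q_inj ik kj jm ccw_ij ikj cik ckj h1 h2).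
Qed.

Lemma card_chain_triangulations_rec i j : (i.+1 < j)%N -> (j <= m)%N ->
  convex_loop q i j -> #|` chain_triangulations i j| =
  (\sum_(i.+1 <= k < j | (0 < orientq i k j)%R)
    #|` chain_triangulations i k| * #|` chain_triangulations k j|)%N.
Proof.
move=> ij jm loop; rewrite card_fset_sum1.
(* Each triangulation has exactly one base triangle, so the inner sum over apexes is 1. *)
have -> : (\sum_(T <- chain_triangulations i j) 1 =
  \sum_(T <- chain_triangulations i j)
    \sum_(i.+1 <= k < j | (0 < orientq i k j)%R) (tri i k j \in T))%N.
  apply: eq_big_seq => T /(in_chain_triangulations _ _ jm) chT.
  have [k [ik kj ikj Tm]] := loop_base_triangle ij jm loop chT.
  rewrite big_mkcond (bigD1_seq k) ?iota_uniq ?mem_index_iota ?ik //=.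
  rewrite ikj Tm big1_seq ?addn0 // => k' /andP[nk].
  rewrite mem_index_iota => /andP[ik' kj']; case: ifP => // _.
  apply/eqP; rewrite eqb0; apply: contra nk => Tm'; apply/eqP.
  exact: (loop_base_unique ij jm loop ik kj ikj chT Tm ik' kj' Tm').
rewrite exchange_big /= big_nat_cond [RHS]big_nat_cond; apply: eq_bigr => k.
move=> /andP[/andP[ik kj] ikj]; rewrite -card_chain_triangulations_base //.
rewrite card_fset_sum1 -[RHS]big_fset_condE [RHS]big_mkcond /=.
by apply: eq_bigr => T _; case: (_ \in _).
Qed.

End Counting.

(** * Polygons given by labelled points *)

Section LabelledPolygon.
Variables (R : realType) (q : nat -> plane R) (e : nat -> nat) (l n : nat).
Variable C : {fset plane R}.
Implicit Types (i j k a b c r : nat) (p : plane R) (t s : {fset plane R}).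
Implicit Types (T : {fset {fset plane R}}).

Local Notation orientq a b c := (orient (q a) (q b) (q c)).

Hypothesis q_inj : forall a b, (a <= n)%N -> (b <= n)%N -> q a = q b -> a = b.
Hypothesis CE : forall x, x \in C <-> exists2 a, (a <= n)%N & x = q a.
Hypothesis e_lt : forall i, (i <= n)%N -> (e i < l)%N.
Hypothesis e_mono : forall i j, (i <= j)%N -> (j <= n)%N -> (e i <= e j)%N.
Hypothesis ccw_q : ccw_chain q 0 n.
(** [e k.-1] rather than [e k], because the end vertex of an edge carries the label of the next one.
    The second case is the last edge, whose end vertex is [q 0], listed first. *)
Hypothesis orient_eq0 : forall i j k, (i < j)%N -> (j < k)%N -> (k <= n)%N ->
  orientq i j k = 0 ->
  e i = e k.-1 /\ segment (q i) (q k) (q j) \/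
  [/\ i = 0%N, e j = e n & segment (q j) (q 0%N) (q k)].
Hypothesis orient_same_edge : forall i j k, (i < j)%N -> (j < k)%N -> (k <= n)%N ->
  e i = e k.-1 -> orientq i j k = 0.
Hypothesis orient_last_edge : forall j k, (0 < j)%N -> (j < k)%N -> (k <= n)%N ->
  e j = e n -> orientq 0 j k = 0.
Hypothesis n_gt1 : (1 < n)%N.
Hypothesis e_first_last : e 0%N != e n.-1.

(** The side condition keeps [q 0] and points with the last label from occurring together; only they
    form collinear triples that are out of order. *)
Lemma labelled_convex_chain i j : (j <= n)%N -> (0 < i)%N \/ e j <> e n ->
  convex_chain q i j.
Proof.
move=> jn ij; split=> [a b c *|a b c ia ab bc cj e0]; first by apply: ccw_q => //; lia.
have cn := leq_trans cj jn.
have [[_ //]|[a0 eb _]] := orient_eq0 ab bc cn e0.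
case: ij => [i0|]; first by move: ia; rewrite a0; lia.
have h1 := e_mono (leq_trans (ltnW bc) cj) jn; have h2 := e_mono jn (leqnn n).
by case; apply/eqP; rewrite eqn_leq h2 -eb h1.
Qed.

Lemma convex_chain_loop i j : (j <= n)%N -> convex_chain q i j -> convex_loop q i j.
Proof.
move=> jn cij; split; first by case: cij.
- move=> k ik kj _; split; first by apply: convex_chain_sub cij => //; exact: ltnW.
  by apply: convex_chain_sub cij => //; exact: ltnW.
- move=> k r ir rj irj ik kj e0.
  have := convex_chain_base q_inj jn cij (leqnn i) ir rj (leqnn j) irj ik kj.
  by rewrite e0 ltxx.
Qed.

(** Inner points collinear with the base have the last label, and [q n] lies between them and [q 0],
    as the third clause of [convex_loop] allows. *)
Lemma labelled_loop : convex_loop q 0 n.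
Proof.
split=> // [k k0 kn ikn|k r _ _ _ k0 kn e0].
  split; last by apply: labelled_convex_chain => //; left.
  apply: labelled_convex_chain; [exact: ltnW|right=> ek].
  by move: ikn; rewrite orient_last_edge ?ltxx.
have [[e1 _]|[_ _ //]] := orient_eq0 k0 kn (leqnn n) e0.
by have := e_first_last; rewrite e1 eqxx.
Qed.

Let qC a : (a <= n)%N -> q a \in C. Proof. by move=> an; apply/CE; exists a. Qed.

Local Notation count i j := #|` chain_triangulations q C i j|%fset.
Local Notation Q := (path_poly e l).

(** Both sides satisfy the same recursion. On a single edge there is no apex and both vanish beyond
    one step; otherwise every inner point is an apex and the coefficient of [t] is 0. *)
Lemma card_chain_path_count i j : (i < j)%N -> (j <= n)%N -> (0 < i)%N \/ e j <> e n ->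
  (count i j)%:R = path_count 0 (Q i j) :> int.
Proof.
have el i' : (i' < n.+1)%N -> (e i' < l)%N by apply: e_lt.
have em i' j' : (i' <= j')%N -> (j' < n.+1)%N -> (e i' <= e j')%N by apply: e_mono.
move: {2}(j - i)%N (leqnn (j - i)) => d; elim: d i j => [|d IH] i j jid ij jn h.
  by move: jid; rewrite leqNgt subn_gt0 ij.
have jn1 : (j <= n.+1)%N by exact: leqW.
have [ij1|ij1|ij1] := ltngtP i.+1 j; last first.
- rewrite -ij1 in jn *; rewrite (card_chain_triangulations_edge (m := n)) //.
  by rewrite (@path_count_path_poly_flat e l n.+1) ?eqxx // leqW.
- by move: ij1; rewrite ltnS leqNgt ij.
have cij := labelled_convex_chain jn h.
have lij := convex_chain_loop jn cij.
rewrite (card_chain_triangulations_rec q_inj qC ij1 jn lij).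
have [eij|neij] := eqVneq (e i) (e j.-1).
  rewrite (@path_count_path_poly_flat e l n.+1) // (gtn_eqF ij1) big_nat_cond big1 //.
  move=> k /andP[/andP[ik kj]]; rewrite orient_same_edge ?ltxx //.
have ejn k : (k < j)%N -> (0 < i)%N \/ e k <> e n.
  move=> kj; case: h => [i0|enj]; [by left|right=> ek].
  have h1 := e_mono (ltnW kj) jn; have h2 := e_mono jn (leqnn n).
  by case: enj; apply/eqP; rewrite eqn_leq h2 -ek h1.
rewrite (@path_count_path_poly e l n.+1) // (@path_poly_coef1 e l n.+1) //.
rewrite (gtn_eqF ij1) (_ : _ && _ = false); last first.
  by apply: contraNF neij => /andP[/eqP-> /eqP->].
rewrite [_%:R - _]subrr addr0 natr_sum big_mkcond; apply: eq_big_nat => k /andP[ik kj].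
have -> : 0 < orientq i k j.
  rewrite lt_neqAle eq_sym ccw_q ?(ltnW ik) ?(ltnW kj) // andbT; apply/eqP => e0.
  have [[eij _]|[i0 ek _]] := orient_eq0 ik kj jn e0; first by rewrite eij eqxx in neij.
  by have [|] := ejn k kj; rewrite ?i0 ?ltnn.
have kn := leq_trans (ltnW kj) jn; have k0 : (0 < k)%N by exact: leq_ltn_trans ik.
rewrite natrM !IH //; [|by left| |exact: ejn].
  by move: jid; rewrite !leq_subLR; lia.
by move: jid; rewrite !leq_subLR; lia.
Qed.

(** The apexes over the base are the points off the last edge, which is the range of summation in
    [catalan_pairing_path_poly]. *)
Lemma card_loop : (count 0 n)%:R = catalan_pairing (Q 0 n.+1) :> int.
Proof.
rewrite (card_chain_triangulations_rec q_inj qC n_gt1 (leqnn n) labelled_loop).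
rewrite catalan_pairing_path_poly // natr_sum big_nat_cond [RHS]big_nat_cond.
have cond k : (0 < k)%N -> (k < n)%N -> (0 < orientq 0 k n) = (e k != e n).
  move=> k0 kn; rewrite lt_neqAle eq_sym ccw_q ?(ltnW kn) // andbT; congr (~~ _).
  apply/eqP/eqP => [e0|]; last exact: orient_last_edge.
  have [[e1 _]|[_ //]] := orient_eq0 k0 kn (leqnn n) e0.
  by have := e_first_last; rewrite e1 eqxx.
apply: eq_big => [k|k /andP[/andP[k0 kn] k0n]].
  by case: (boolP (_ <= k < n)%N) => // /andP[k0 kn]; rewrite cond.
rewrite natrM !card_chain_path_count //; [by left|exact: ltnW|right].
by apply/eqP; rewrite -cond.
Qed.

Lemma pointsE : points q 0 n = [set` C].
Proof.
apply/seteqP; split=> x; first by move=> [a /andP[_ an] ->]; apply: qC.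
by move=> /CE[a an ->]; exists a.
Qed.

Lemma tri_is_tri a b c : (a <= n)%N -> (b <= n)%N -> (c <= n)%N ->
  orientq a b c != 0 -> is_tri q 0 n (tri q a b c).
Proof.
have sorted x y z : (x < y)%N -> (y < z)%N -> (z <= n)%N -> orientq x y z != 0 ->
    is_tri q 0 n (tri q x y z).
  move=> xy yz zn h; exists x, y, z; split=> //; split=> //.
  by rewrite lt_neqAle eq_sym h ccw_q ?(ltnW xy) ?(ltnW yz).
have s12 x y z : tri q x y z = tri q y x z.
  by apply/fsetP => u; rewrite !in_fset3 orbCA.
have s23 x y z : tri q x y z = tri q x z y.
  by apply/fsetP => u; rewrite !in_fset3 (orbC (u == q y)).
have o12 x y z : (orientq x y z != 0) = (orientq y x z != 0).
  by rewrite orient_swap oppr_eq0.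
have o23 x y z : (orientq x y z != 0) = (orientq x z y != 0).
  by rewrite orient_swapr oppr_eq0.
move=> an bn cn; have [ab|ba|->] := ltngtP a b; last by rewrite orient_aa eqxx.
  have [bc|cb|->] := ltngtP b c; last by rewrite orient_abb eqxx.
    exact: sorted.
  have [ac|ca|->] := ltngtP a c; last by rewrite orient_aba eqxx.
    by rewrite s23 o23; apply: sorted.
  by rewrite s23 s12 o23 o12; apply: sorted.
have [ac|ca|->] := ltngtP a c; last by rewrite orient_aba eqxx.
  by rewrite s12 o12; apply: sorted.
have [bc|cb|->] := ltngtP b c; last by rewrite orient_abb eqxx.
  by rewrite s12 s23 o12 o23; apply: sorted.
by rewrite s12 s23 s12 o12 o23 o12; apply: sorted.
Qed.

Lemma maximal_triangulationE T :
  maximal_triangulation C T <-> chain_triangulation q 0 n T.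
Proof.
split=> [[[tt cov mt] used]|chT].
  have tri_t t : t \in T -> is_tri q 0 n t.
    move=> /tt[/fsubsetP tC [x [y [z [te h]]]]].
    have inC u : u \in t -> exists2 a, (a <= n)%N & u = q a by move=> /tC /CE.
    have [|a an xa] := inC x; first by rewrite te in_fset3 eqxx.
    have [|b bn yb] := inC y; first by rewrite te in_fset3 eqxx orbT.
    have [|c cn zc] := inC z; first by rewrite te in_fset3 eqxx !orbT.
    by rewrite te xa yb zc; apply: tri_is_tri => //; rewrite -xa -yb -zc.
  split=> //.
  - move=> p; rewrite pointsE -/(hull C) -cov => -[t tT tp] _.
    by exists t.
  - by move=> k _ kn; apply/used/qC/ltnW.
  (* By maximality [q k] is a vertex of some triangle, and proper meeting makes it a vertex of every
     triangle that contains it. *)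
  - move=> t k tT /andP[_ kn] tk; have [s sT sk] := used _ (qC kn).
    have [<-//|st] := eqVneq s t.
    apply: (meet_properly_vertex _ (mt s t sT tT st) sk tk).
    exact: (is_tri_nondegenerate (tri_t s sT)).
have [k /andP[k0 kn] ikn] := loop_apex q_inj n_gt1 (leqnn n) labelled_loop chT.
have cov := chain_cover k0 kn ccw_q ikn chT.
have [tt _ mt _ em] := chT; split; first split=> //.
- move=> t /tt ht; split; last exact: is_tri_nondegenerate ht.
  by apply/fsubsetP => x /(is_tri_points ht); rewrite pointsE.
- apply/seteqP; split=> p.
    by move=> [t /= /tt /is_tri_hull h /h]; rewrite pointsE.
  by rewrite /hull -pointsE => /cov[t tT tp]; exists t.
(* The fourth clause leaves out [q 0] and [q n]; any triangle covering the point has it as a vertex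
   by the last clause. *)
- move=> c cC; have [a an ca] := (CE c).1 cC.
  have [|t tT tc] := cov c; first by rewrite pointsE; apply: sub_hull.
  by exists t => //; rewrite ca; apply: em => //; rewrite -ca.
Qed.

Lemma tau_max_labelled : (tau_max C)%:Z = catalan_pairing (Q 0 n.+1).
Proof.
rewrite -card_loop -natz; congr (_%:R); rewrite /tau_max /chain_triangulations.
congr #|` _|%fset; apply/fsetP => T; rewrite !inE /=; congr (_ && _).
by apply: asbool_equiv_eq; exact: maximal_triangulationE.
Qed.

End LabelledPolygon.

(** * The boundary points in cyclic order *)

(** Otherwise the hull without [p] would be a convex set containing [S]. *)
Lemma extremal_hull_mem (R : realType) (S : set (plane R)) p :
  extremal_points (convex_hull S) p -> S p.
Proof.
move=> [Hp ext]; apply: contrapT => nSp.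
suff /(_ p Hp)[] : convex_hull S `<=` (convex_hull S `&` [set x | x <> p]) by [].
apply: hull_ind => [x Sx|t x y t01 [Hx xp] [Hy yp]] /=.
  by split=> [|xp]; [exact: sub_hull|apply: nSp; rewrite -xp].
split=> [|e]; first exact: hull_mix.
have [|px|py] := ext x y Hx Hy; first by apply/segmentP; exists t.
  by apply: xp.
by apply: yp.
Qed.

Lemma mix_inj (R : realType) (x y : plane R) s t : x != y ->
  mix s x y = mix t x y -> s = t.
Proof.
move=> xy /rowP h; apply/eqP; apply: contraT => st.
have ts : t - s != 0 by rewrite subr_eq0 eq_sym.
have e i : x 0 i = y 0 i.
  apply: (mulfI ts); have := h i; rewrite !mixE => e.
  apply/eqP; rewrite -subr_eq0; apply/eqP.
  have -> : (t - s) * x 0 i - (t - s) * y 0 i =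
    ((1 - s) * x 0 i + s * y 0 i) - ((1 - t) * x 0 i + t * y 0 i) by ring.
  by rewrite e subrr.
by case/eqP: xy; apply: planeP.
Qed.

Lemma mix_segment (R : realType) (x y : plane R) r s t : r <= s <= t ->
  segment (mix r x y) (mix t x y) (mix s x y).
Proof.
move=> /andP[rs st]; apply/segmentP; have [rt|rt] := eqVneq r t.
  by exists 0; rewrite ?lexx ?ler01 // mix0 (_ : s = r) //; lra.
have trn : t - r != 0 by rewrite subr_eq0 eq_sym.
have tr : 0 < t - r by rewrite subr_gt0 lt_neqAle rt (le_trans rs).
exists ((s - r) / (t - r)); first by apply: divr_itv01 => //; lra.
by apply: planeP; rewrite !mixE; field.
Qed.

Lemma orient_mix_edge (R : realType) (x y z : plane R) s t :
  orient (mix s x y) (mix t x y) z = (t - s) * orient x y z.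
Proof. by rewrite /orient !mixE; ring. Qed.

Lemma extremal_not_collinear (R : realType) (S : set (plane R)) x y z :
  extremal_points (convex_hull S) x -> extremal_points (convex_hull S) y ->
  extremal_points (convex_hull S) z -> x <> y -> y <> z -> x <> z ->
  orient x y z != 0.
Proof.
move=> [Hx ex] [Hy ey] [Hz ez] xy yz xz; apply/eqP => e0.
have xy' : x != y by apply/eqP.
have [t et] := collinear_mix xy' e0.
have [t0|t0] := ltP t 0.
  have : segment y z x.
    rewrite segmentC et -[X in segment _ X _](mix1 x y) -[X in segment _ _ X](mix0 x y).
    by apply: mix_segment; rewrite ltW //= ler01.
  by move=> /(ex _ _ Hy Hz)[].
have [t1|t1] := ltP 1 t.
  have : segment x z y.
    rewrite et -[X in segment X _ _](mix0 x y) -[X in segment _ _ X](mix1 x y).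
    by apply: mix_segment; rewrite ler01 ltW.
  by move=> /(ey _ _ Hx Hz)[/esym|].
have : segment x y z by apply/segmentP; exists t; rewrite ?t0.
by move=> /(ez _ _ Hx Hy)[/esym|/esym].
Qed.

Section CyclicVertices.
Variables (R : realType) (C : {fset plane R}) (l : nat) (V : nat -> plane R).
Hypothesis l_ge3 : (2 < l)%N.
Hypothesis V_period : forall i, V (i + l) = V i.
Hypothesis V_inj : forall i j, (i < l)%N -> (j < l)%N -> V i = V j -> i = j.
Hypothesis V_extremal : forall i, extremal_points (hull C) (V i).
Hypothesis V_left : forall i c, c \in C -> 0 <= orient (V i) (V i.+1) c.

Lemma V_modn i : V i = V (i %% l).
Proof.
rewrite {1}(divn_eq i l) addnC; elim: (i %/ l)%N => [|d IH]; first by rewrite addn0.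
by rewrite mulSn addnCA addnC V_period.
Qed.

Lemma V_neq i j : (i < j)%N -> (j < i + l)%N -> V i != V j.
Proof.
move=> ij ji; apply/eqP; rewrite (V_modn i) (V_modn j) => /V_inj e.
have l0 : (0 < l)%N by exact: ltn_trans l_ge3.
have /eqP : (i %% l = j %% l)%N by apply: e; rewrite ltn_mod.
rewrite eq_sym eqn_mod_dvd ?(ltnW ij) // => /dvdn_leq; rewrite subn_gt0 => /(_ ij).
by rewrite leqNgt ltn_subLR ?(ltnW ij) // ji.
Qed.

Lemma V_mem i : V i \in C.
Proof. exact: (extremal_hull_mem (V_extremal i)). Qed.

Lemma orient_V_edge i k : (i.+1 < k)%N -> (k < i + l)%N ->
  0 < orient (V i) (V i.+1) (V k).
Proof.
move=> ik ki; rewrite lt_neqAle V_left ?V_mem // andbT eq_sym.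
apply: (extremal_not_collinear (V_extremal _) (V_extremal _) (V_extremal _)).
- by apply/eqP/V_neq; lia.
- by apply/eqP/V_neq; lia.
- by apply/eqP/V_neq; lia.
Qed.

(** Induction on [k] with the Pluecker relation at [V i] for [V i.+1, V j, V k, V k.+1]: the new
    area times a positive one is a nonnegative product plus a positive one. *)
Lemma orient_V i j k : (i < j)%N -> (j < k)%N -> (k < i + l)%N ->
  0 < orient (V i) (V j) (V k).
Proof.
move=> ij; elim: k => // k IH; rewrite ltnS => jk ki.
have step x : (i < x)%N -> (x.+1 < i + l)%N -> 0 < orient (V i) (V x) (V x.+1).
  move=> ix xi; rewrite orient_rot -(V_period i); apply: orient_V_edge => //.
  by rewrite ltn_add2r.
move: jk; rewrite leq_eqVlt => /predU1P[ejk|jk].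
  by rewrite -ejk in ki *; apply: step.
have := orient_pluecker (V i) (V i.+1) (V j) (V k) (V k.+1).
have h1 : 0 <= orient (V i) (V i.+1) (V j) by apply/V_left/V_mem.
have h2 : 0 < orient (V i) (V k) (V k.+1) by apply: step => //; lia.
have h3 : 0 < orient (V i) (V i.+1) (V k) by apply: orient_V_edge; lia.
have h4 : 0 < orient (V i) (V i.+1) (V k.+1) by apply: orient_V_edge; lia.
have h5 : 0 < orient (V i) (V j) (V k) by apply: IH; lia.
move=> e; rewrite -(pmulr_rgt0 _ h3).
have -> : orient (V i) (V i.+1) (V k) * orient (V i) (V j) (V k.+1) =
  orient (V i) (V i.+1) (V j) * orient (V i) (V k) (V k.+1) +
  orient (V i) (V i.+1) (V k.+1) * orient (V i) (V j) (V k).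
  by apply/eqP; rewrite -subr_eq0 -oppr_eq0 -[X in _ == X]e; apply/eqP; ring.
by apply: ltr_wpDl; [rewrite mulr_ge0 // ltW|rewrite mulr_gt0].
Qed.

Lemma orient_V_edge_ge0 i k : 0 <= orient (V i) (V i.+1) (V k).
Proof. exact/V_left/V_mem. Qed.

(** Fan from [V 0]: [p] is to the left of [V 0 V 1] and to the right of [V 0 V l.-1], so the side
    changes between two consecutive rays and [p] lies in their triangle. *)
Lemma hull_fan p : (forall i, 0 < orient (V i) (V i.+1) p) -> hull C p.
Proof.
move=> h; have last0 : orient (V 0) (V l.-1) p < 0.
  rewrite -[V 0%N]V_period add0n orient_swap oppr_lt0.
  by have := h l.-1; rewrite prednK // (ltn_trans _ l_ge3).
have [k [k0 kl h1 h2]] : exists k, [/\ (0 < k)%N, (k.+1 < l)%N,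
    0 <= orient (V 0) (V k) p & orient (V 0) (V k.+1) p < 0].
  have l1 : (0 < l.-1)%N by lia.
  have : (l.-1 < l)%N by lia.
  elim: l.-1 l1 last0 => // d IH _ last0 dl.
  have [d0|d0] := posnP d; first by have := h 0%N; rewrite -d0; rewrite d0 in last0 *; lra.
  have [hd|hd] := ltP (orient (V 0) (V d) p) 0; first by apply: IH => //; exact: ltnW.
  by exists d.
apply: (@triangle_hull _ _ (V 0%N) (V k) (V k.+1)) => /=; try exact: V_mem.
- by apply: orient_V.
- exact: h1.
- exact: ltW.
- by rewrite orient_swap oppr_ge0 ltW.
Qed.

Lemma orient_near a b c : 0 < orient a b c -> \forall p \near c, 0 < orient a b p :> R.
Proof.
move=> h; suff cv : orient a b p @[p --> c] --> orient a b c.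
  exact: (cvgr_gt (orient a b c) cv).
have cc i : (fun p : plane R => p 0 i) @ c --> c 0 i by exact: coord_continuous.
have lin i x y : (x * (p 0 i - y)) @[p --> c] --> x * (c 0 i - y).
  apply: (@cvgM R _ (nbhs c) _ (fun=> x) (fun p : plane R => p 0 i - y)).
    exact: cvg_cst.
  apply: (@cvgB R _ _ (nbhs c) _ (fun p : plane R => p 0 i) (fun=> y)) => //.
  exact: cvg_cst.
exact: cvgB (lin _ _ _) (lin _ _ _).
Qed.

(** Lying strictly to the left of all edges is an open condition, so by [hull_fan] it makes a point
    interior. *)
Lemma boundary_on_edge c : c \in C -> boundary (hull C) c ->
  exists2 i, (i < l)%N & orient (V i) (V i.+1) c = 0.
Proof.
move=> cC [_ nint]; apply: contrapT => none; apply: nint.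
have pos (i : 'I_l) : 0 < orient (V i) (V i.+1) c.
  by rewrite lt_neqAle V_left // andbT eq_sym; apply/eqP => e; apply: none; exists i.
have : \forall p \near c, forall i : 'I_l, 0 < orient (V i) (V i.+1) p.
  apply: (@filter_forall _ 'I_l (fun i p => 0 < orient (V i) (V i.+1) p) (nbhs c)) => i.
  exact: orient_near.
apply: filterS => p hp; apply: hull_fan => i.
have il : (i %% l < l)%N by rewrite ltn_mod (ltn_trans _ l_ge3).
have := hp (Ordinal il); rewrite /= -V_modn [V (i %% l)%N.+1]V_modn.
by rewrite -addn1 modnDml addn1 -V_modn.
Qed.

(** The half-open range of [t] assigns a vertex to the edge that it starts, which makes the pair
    [(i, t)] unique. *)
Lemma edge_param c : c \in C -> boundary (hull C) c ->
  exists i t, [/\ (i < l)%N, 0 <= t < 1 & c = mix t (V i) (V i.+1)].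
Proof.
move=> cC /(boundary_on_edge cC)[i il e0].
have n1 : V i != V i.+1 by apply: V_neq => //; lia.
have [t et] := collinear_mix n1 e0.
(* The preceding edge bounds [t] from below, the following one from above. *)
have t0 : 0 <= t.
  have hl : (0 < l)%N by exact: ltn_trans l_ge3.
  have ep : (i + l.-1).+1 = (i + l)%N by rewrite -addnS prednK.
  have := V_left (i + l.-1) cC; rewrite ep V_period et affine_orient orient_abb mulr0 add0r.
  have h : 0 < orient (V (i + l.-1)) (V (i + l.-1).+1) (V (i.+1 + l)).
    by apply: orient_V_edge; lia.
  by rewrite ep !V_period in h; rewrite pmulr_lge0.
have t1 : t <= 1.
  have := V_left i.+1 cC; rewrite et affine_orient orient_aba mulr0 addr0.
  have h : 0 < orient (V i.+1) (V i.+2) (V (i + l)) by apply: orient_V_edge; lia.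
  by rewrite V_period in h; rewrite pmulr_lge0 // subr_ge0.
have [t1'|t1'] := eqVneq t 1; last first.
  by exists i, t; rewrite t0 lt_neqAle t1' t1.
exists (i.+1 %% l)%N, 0; rewrite lexx ltr01 ltn_mod (ltn_trans _ l_ge3) // mix0.
by rewrite -V_modn et t1' mix1.
Qed.

Lemma edge_param_unique i j s t : (i < l)%N -> (j < l)%N -> 0 <= s < 1 -> 0 <= t < 1 ->
  mix s (V i) (V i.+1) = mix t (V j) (V j.+1) -> i = j /\ s = t.
Proof.
have lt_absurd i' j' s' t' : (i' < j')%N -> (j' < l)%N -> 0 <= s' < 1 -> 0 <= t' < 1 ->
    mix s' (V i') (V i'.+1) = mix t' (V j') (V j'.+1) -> False.
  move=> ij jl /andP[s0 s1] /andP[t0 t1] e.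
  have := congr1 (orient (V i') (V i'.+1)) e.
  rewrite !affine_orient orient_aba orient_abb !mulr0 addr0.
  have g := orient_V_edge_ge0 i' j'.+1.
  move: ij; rewrite leq_eqVlt => /predU1P[ej|ij].
    rewrite -ej orient_abb mulr0 add0r => /esym/eqP; rewrite mulf_eq0.
    have h : 0 < orient (V i') (V i'.+1) (V i'.+2) by apply: orient_V_edge; lia.
    rewrite (gt_eqF h) orbF => /eqP tz.
    have n1 : V i' != V i'.+1 by apply: V_neq => //; lia.
    move: e; rewrite -ej tz mix0 -{2}(mix1 (V i') (V i'.+1)) => /(mix_inj n1) s1'.
    by rewrite s1' ltxx in s1.
  have h : 0 < orient (V i') (V i'.+1) (V j') by apply: orient_V_edge => //; lia.
  have h' : 0 < (1 - t') * orient (V i') (V i'.+1) (V j') by rewrite mulr_gt0 // subr_gt0.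
  have h'' : 0 <= t' * orient (V i') (V i'.+1) (V j'.+1) by rewrite mulr_ge0.
  by move=> e0; have := ltr_wpDr h'' h'; rewrite -e0 ltxx.
move=> il jl s01 t01 e; have [ij|ji|ij] := ltngtP i j.
- by case: (lt_absurd i j s t).
- by case: (lt_absurd j i t s).
split=> //; rewrite -ij in e; apply: mix_inj e; apply: V_neq => //; lia.
Qed.

(** Expanding along the edges gives a nonnegative combination of areas of vertex triples. It
    vanishes only on a single edge, whose end vertex has the key [(i.+1, 0)], or on the last edge
    together with [V 0], its end vertex but the first in the order. *)
Lemma orient_keys i j k r s t : (i <= j)%N -> (j <= k)%N -> (k < l)%N ->
  0 <= r < 1 -> 0 <= s < 1 -> 0 <= t < 1 ->
  (i = j -> r < s) -> (j = k -> s < t) ->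
  let o := orient (mix r (V i) (V i.+1)) (mix s (V j) (V j.+1)) (mix t (V k) (V k.+1)) in
  0 <= o /\ (o = 0 -> i = j /\ (k = i \/ (k = i.+1 /\ t = 0)) \/
                      [/\ i = 0%N, r = 0, j = l.-1 & k = l.-1]).
Proof.
move=> ij jk kl /andP[r0 r1] /andP[s0 s1] /andP[t0 t1] rs st.
have pos2 x : 0 < orient (V x) (V x.+1) (V x.+2).
  by apply: orient_V_edge => //; rewrite -addn2 ltn_add2l.
move: ij; rewrite leq_eqVlt => /predU1P[eij|ij].
  rewrite -eij in jk rs st *; rewrite /= orient_mix_edge.
  have sr : 0 < s - r by rewrite subr_gt0 rs.
  rewrite affine_orient; set A := orient _ _ (V k); set B := orient _ _ (V k.+1).
  have A0 : 0 <= A by exact: orient_V_edge_ge0.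
  have B0 : 0 <= B by exact: orient_V_edge_ge0.
  have h1 : 0 <= (1 - t) * A by rewrite mulr_ge0 // subr_ge0 ltW.
  have h2 : 0 <= t * B by rewrite mulr_ge0.
  split; first by apply: mulr_ge0; [exact: ltW|exact: addr_ge0].
  move=> /eqP; rewrite mulf_eq0 (gt_eqF sr) orFb.
  rewrite (paddr_eq0 h1 h2) !mulf_eq0 => /andP[].
  have -> : (1 - t == 0) = false by rewrite subr_eq0 gt_eqF.
  rewrite orFb => /eqP A00 BB; left; split=> //.
  move: jk; rewrite leq_eqVlt => /predU1P[->|ik]; first by left.
  right; move: ik; rewrite leq_eqVlt => /predU1P[ek|ik].
    split=> //; move: BB; rewrite /B -ek => /orP[/eqP//|].
    by rewrite (gt_eqF (pos2 i)).
  have ki : (k < i + l)%N by rewrite (leq_trans kl) // leq_addl.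
  by have := orient_V_edge ik ki; rewrite -/A A00 ltxx.
move: jk; rewrite leq_eqVlt => /predU1P[ejk|jk].
  rewrite -ejk in kl st *; rewrite /= orient_rot orient_mix_edge.
  have ts : 0 < t - s by rewrite subr_gt0 st.
  rewrite affine_orient; set A := orient _ _ (V i); set B := orient _ _ (V i.+1).
  have A0 : 0 <= A by exact: orient_V_edge_ge0.
  have B0 : 0 <= B by exact: orient_V_edge_ge0.
  have h1 : 0 <= (1 - r) * A by rewrite mulr_ge0 // subr_ge0 ltW.
  have h2 : 0 <= r * B by rewrite mulr_ge0.
  split; first by apply: mulr_ge0; [exact: ltW|exact: addr_ge0].
  move=> /eqP; rewrite mulf_eq0 (gt_eqF ts) orFb.
  rewrite (paddr_eq0 h1 h2) !mulf_eq0 => /andP[].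
  have -> : (1 - r == 0) = false by rewrite subr_eq0 gt_eqF.
  rewrite orFb => /eqP A00 BB; right.
  (* [V i] lies on the line of a later edge [j] only as its end vertex, so that edge is the last one
     and [i = 0]. *)
  have [i0 jl] : i = 0%N /\ j = l.-1.
    have [|bad] := leqP (i + l) j.+1; first by clear -kl; lia.
    have jil : (i + l < j + l)%N by rewrite ltn_add2r.
    by have := orient_V_edge bad jil; rewrite V_period -/A A00 ltxx.
  have jS : j.+1 = l by rewrite jl prednK // (ltn_trans _ l_ge3).
  have := pos2 j; have -> : V j.+2 = V i.+1 by rewrite jS i0 -(V_period 1%N) add1n.
  rewrite -/B => B1; move: BB; rewrite (gt_eqF B1) orbF => /eqP ->.
  by rewrite i0 -jl.
have kil : (k < i + l)%N by rewrite (leq_trans kl) // leq_addl.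
(* On three different edges the triple [V i, V j, V k] has positive area and positive weight. *)
have pos : 0 < orient (mix r (V i) (V i.+1)) (mix s (V j) (V j.+1)) (mix t (V k) (V k.+1)).
  have a3 x y u z z' : orient (mix u z z') x y =
      (1 - u) * orient z x y + u * orient z' x y by rewrite /orient !mixE; ring.
  have a2 x y u z z' : orient x (mix u z z') y =
      (1 - u) * orient x z y + u * orient x z' y by rewrite /orient !mixE; ring.
  have wpos (x a b : R) : 0 <= x -> x < 1 -> 0 < a -> 0 <= b -> 0 < (1 - x) * a + x * b.
    move=> x0 x1 a0 b0; apply: ltr_wpDr; first by rewrite mulr_ge0.
    by rewrite mulr_gt0 // subr_gt0.
  have ge0 x y z : (x <= y)%N -> (y <= z)%N -> (z <= x + l)%N -> 0 <= orient (V x) (V y) (V z).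
    rewrite leq_eqVlt => /predU1P[->|xy]; first by rewrite orient_aa.
    rewrite leq_eqVlt => /predU1P[->|yz]; first by rewrite orient_abb.
    rewrite leq_eqVlt => /predU1P[->|zx]; first by rewrite V_period orient_aba.
    exact/ltW/orient_V.
  have third x y : (x <= y)%N -> (y <= k)%N -> (k < x + l)%N ->
      0 <= orient (V x) (V y) (mix t (V k) (V k.+1)).
    move=> xy yk kx; rewrite affine_orient.
    apply: addr_ge0; apply: mulr_ge0 => //; first by rewrite subr_ge0 ltW.
      by apply: ge0 => //; exact: ltnW.
    by apply: ge0 => //; exact: leqW.
  have third' : 0 < orient (V i) (V j) (mix t (V k) (V k.+1)).
    rewrite affine_orient; apply: (wpos) => //.
      exact: orient_V kil.
    by apply: ge0 => //; [exact: ltnW|exact: leqW (ltnW jk)].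
  rewrite a3; apply: (wpos) => //.
    rewrite a2.
    apply: (wpos) => //.
      by apply: third; [exact: leqW (ltnW ij)|exact: jk|].
  rewrite a2; apply: addr_ge0; apply: mulr_ge0 => //; first by rewrite subr_ge0 ltW.
    by apply: third; [exact: ij|exact: ltnW|exact: leq_trans kil (leqnSn _)].
  by apply: third; [exact: leqW|exact: jk|exact: leq_trans kil (leqnSn _)].
by split; [exact: ltW|move=> e; move: pos; rewrite e ltxx].
Qed.

End CyclicVertices.

(** * Sorting the points counterclockwise *)

Section SortedPolygon.
Variables (R : realType) (C : {fset plane R}) (l : nat) (V : nat -> plane R).
Variable a : nat -> nat.
Hypothesis l_ge3 : (2 < l)%N.
Hypothesis V_period : forall i, V (i + l) = V i.
Hypothesis V_inj : forall i j, (i < l)%N -> (j < l)%N -> V i = V j -> i = j.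
Hypothesis V_extremal : forall i, extremal_points (hull C) (V i).
Hypothesis V_left : forall i c, c \in C -> 0 <= orient (V i) (V i.+1) c.
Hypothesis V_count : forall i, (i < l)%N ->
  #|` [fset c in C | c \in segment (V i) (V i.+1)]%fset| = (a i).+1.

Variable key : plane R -> nat * R.
Hypothesis keyP : forall c, c \in C ->
  [/\ ((key c).1 < l)%N, 0 <= (key c).2 < 1 &
      c = mix (key c).2 (V (key c).1) (V (key c).1.+1)].

(** The lexicographic order of edge and parameter is the counterclockwise order starting at
    [V 0]. *)
Let le c d := ((key c).1 < (key d).1)%N || ((key c).1 == (key d).1) && ((key c).2 <= (key d).2).
Let s := sort le (enum_fset C).
Let q i := nth (V 0%N) s i.
Let n := (size s).-1.
Let e i := (key (q i)).1.
Let par i := (key (q i)).2.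

Let l_gt0 : (0 < l)%N. Proof. exact: ltn_trans l_ge3. Qed.

Let VC i : V i \in C. Proof. exact: (V_mem V_extremal). Qed.

Let mem_s x : (x \in s) = (x \in C). Proof. by rewrite mem_sort. Qed.

Let s_gt0 : (0 < size s)%N.
Proof. by rewrite lt0n size_eq0; apply/eqP => s0; have := VC 0; rewrite -mem_s s0. Qed.

Let szn i : (i <= n)%N = (i < size s)%N.
Proof. by rewrite -ltnS prednK. Qed.

Let CE x : x \in C <-> exists2 i, (i <= n)%N & x = q i.
Proof.
rewrite -mem_s; split=> [xs|[i]]; last by rewrite szn => h ->; apply: mem_nth.
by exists (index x s); rewrite ?szn ?index_mem // /q nth_index.
Qed.

Let qC i : (i <= n)%N -> q i \in C. Proof. by move=> h; apply/CE; exists i. Qed.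

Let q_inj i j : (i <= n)%N -> (j <= n)%N -> q i = q j -> i = j.
Proof.
rewrite !szn => hi hj /eqP; rewrite nth_uniq // => [/eqP//|].
by rewrite sort_uniq fset_uniq.
Qed.

Let q_par i : (i <= n)%N -> [/\ (e i < l)%N, 0 <= par i < 1 &
  q i = mix (par i) (V (e i)) (V (e i).+1)].
Proof. by move=> /qC/keyP. Qed.

Let s_sorted : sorted le s.
Proof.
apply: sort_sorted => x y; rewrite /le.
by case: ltngtP => //= _; apply: le_total.
Qed.

Let le_trans : transitive le.
Proof.
move=> y x z /orP[h|/andP[/eqP h h']] /orP[g|/andP[/eqP g g']]; rewrite /le.
- by rewrite (ltn_trans h g).
- by rewrite -g h.
- by rewrite h g.
- by rewrite h g eqxx (Order.POrderTheory.le_trans h' g') orbT.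
Qed.

Let q_lt i j : (i < j)%N -> (j <= n)%N -> (e i < e j)%N \/ (e i = e j /\ par i < par j).
Proof.
move=> ij jn; have im := leq_trans (ltnW ij) jn.
have := sorted_ltn_nth le_trans (V 0) s_sorted; move=> /(_ i j).
rewrite !inE -!szn => /(_ im jn ij) /orP[h|/andP[/eqP h h']]; first by left.
right; split=> //; rewrite lt_neqAle h' andbT; apply/eqP => epar.
have [_ _ qi] := q_par im; have [_ _ qj] := q_par jn.
have : q i = q j by rewrite qi qj epar (h : e i = e j).
by move=> /(q_inj im jn) eij; rewrite eij ltnn in ij.
Qed.

Let e_mono i j : (i <= j)%N -> (j <= n)%N -> (e i <= e j)%N.
Proof.
rewrite leq_eqVlt => /predU1P[->//|ij] jn.
by have [/ltnW//|[->]] := q_lt ij jn.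
Qed.

Let e_ltn i j : (i <= n)%N -> (e i < e j)%N -> (i < j)%N.
Proof. by move=> im; apply: contraTT; rewrite -!leqNgt => /e_mono; apply. Qed.

Let key_unique i r t : (i <= n)%N -> (r < l)%N -> 0 <= t < 1 ->
  q i = mix t (V r) (V r.+1) -> e i = r /\ par i = t.
Proof.
move=> im rl t01 qi; have [el p01 qi'] := q_par im.
by apply: (edge_param_unique l_ge3 V_period V_inj V_extremal V_left) => //; rewrite -qi'.
Qed.

Let vertex_index r : (r < l)%N -> exists i, [/\ (i <= n)%N, q i = V r, e i = r & par i = 0].
Proof.
move=> rl; have [i im Vi] := (CE (V r)).1 (VC r).
have t01 : (0 : R) <= 0 < (1 : R) by apply/andP; split; [exact: lexx|exact: ltr01].
have qi : q i = mix 0 (V r) (V r.+1) by rewrite mix0.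
by have [ei pi] := key_unique im rl t01 qi; exists i.
Qed.

Let q0E : q 0 = V 0.
Proof.
have [i [im qi ei pi]] := vertex_index l_gt0; have [i00|i0] := posnP i; first by rewrite i00 in qi.
have [h|[h1 h2]] := q_lt i0 im; first by rewrite ei in h.
have [_ /andP[p0 _] _] := q_par (leq0n n).
by rewrite pi ltNge p0 in h2.
Qed.

Let e_last : e n = l.-1.
Proof.
have ll : (l.-1 < l)%N by rewrite prednK.
have [i [im _ ei _]] := vertex_index ll.
have [en _ _] := q_par (leqnn n).
by apply/eqP; rewrite eqn_leq -ltnS prednK // en -{1}ei e_mono.
Qed.

Let orient_q i j k : (i < j)%N -> (j < k)%N -> (k <= n)%N ->
  let o := orient (q i) (q j) (q k) in
  0 <= o /\ (o = 0 -> e i = e j /\ (e k = e i \/ (e k = (e i).+1 /\ par k = 0)) \/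
                      [/\ e i = 0%N, par i = 0, e j = l.-1 & e k = l.-1]).
Proof.
move=> ij jk kn; have jn := leq_trans (ltnW jk) kn; have im := leq_trans (ltnW ij) jn.
have [ei pi qi] := q_par im; have [ej pj qj] := q_par jn; have [ek pk qk] := q_par kn.
rewrite qi qj qk.
apply: (orient_keys l_ge3 V_period V_inj V_extremal V_left) => //.
- by apply: e_mono => //; exact: ltnW.
- by apply: e_mono => //; exact: ltnW.
- by move=> h; have [|[_]] := q_lt ij jn; rewrite // h ltnn.
- by move=> h; have [|[_]] := q_lt jk kn; rewrite // h ltnn.
Qed.

Let ccw_q : ccw_chain q 0 n.
Proof.
move=> i j k _; rewrite leq_eqVlt => /predU1P[->|ij]; first by rewrite orient_aa.
rewrite leq_eqVlt => /predU1P[->|jk] kn; first by rewrite orient_abb.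
by have [] := orient_q ij jk kn.
Qed.

Let e_pred_next k : (0 < k)%N -> (k <= n)%N -> par k = 0 -> (e k.-1 < e k)%N.
Proof.
move=> k0 kn pk; have kk : (k.-1 < k)%N by rewrite prednK.
have [//|[_]] := q_lt kk kn.
have [_ /andP[p0 _] _] := q_par (leq_trans (leq_pred k) kn).
by rewrite pk ltNge p0.
Qed.

Let orient_eq0 i j k : (i < j)%N -> (j < k)%N -> (k <= n)%N ->
  orient (q i) (q j) (q k) = 0 ->
  e i = e k.-1 /\ segment (q i) (q k) (q j) \/
  [/\ i = 0%N, e j = e n & segment (q j) (q 0%N) (q k)].
Proof.
move=> ij jk kn o0; have jn := leq_trans (ltnW jk) kn; have im := leq_trans (ltnW ij) jn.
have [ei pi qi] := q_par im; have [ej pj qj] := q_par jn; have [ek pk qk] := q_par kn.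
have [_ /(_ o0)] := orient_q ij jk kn.
have k0 : (0 < k)%N by exact: leq_ltn_trans jk.
have jk1 : (j <= k.-1)%N by rewrite -ltnS prednK.
have k1n : (k.-1 <= n)%N by exact: leq_trans (leq_pred k) kn.
have h1 : (e i <= e k.-1)%N by apply: e_mono => //; exact: leq_trans (ltnW ij) jk1.
have h2 : (e k.-1 <= e k)%N by apply: e_mono => //; exact: leq_pred.
have pij : e i = e j -> par i < par j.
  by move=> h; have [|[_]] := q_lt ij jn; rewrite // h ltnn.
have pjk : e j = e k -> par j < par k.
  by move=> h; have [|[_]] := q_lt jk kn; rewrite // h ltnn.
move=> [[eij [eki|[eki pk0]]]|[e0 p0 ejl ekl]].
- left; split; first by rewrite eki in h2; apply/eqP; rewrite eqn_leq h1 h2.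
  rewrite qi qj qk eki -eij; apply: mix_segment.
  by rewrite !ltW ?pij ?pjk // -eij eki.
- left; split.
    have := e_pred_next k0 kn pk0; rewrite eki ltnS => h3.
    by apply/eqP; rewrite eqn_leq h1 h3.
  rewrite qi qj qk eki pk0 mix0 -eij -[X in segment _ X _](mix1 (V (e i))).
  by apply: mix_segment; rewrite (ltW (pij eij)) ltW //; case/andP: pj.
right; split; last 1 first.
- rewrite q0E qj qk ejl ekl prednK // -[V 0%N]V_period add0n.
  rewrite -[X in segment _ X _](mix1 (V l.-1)); apply: mix_segment.
  by rewrite ltW ?pjk ?ejl ?ekl //= ltW //; case/andP: pk.
- have [//|i0] := posnP i; have [|[_]] := q_lt i0 im; first by rewrite e0.
  by have [_ /andP[h _] _] := q_par (leq0n n); rewrite p0 ltNge h.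
- by rewrite ejl e_last.
Qed.

Let orient_same_edge i j k : (i < j)%N -> (j < k)%N -> (k <= n)%N ->
  e i = e k.-1 -> orient (q i) (q j) (q k) = 0.
Proof.
move=> ij jk kn eik; have jn := leq_trans (ltnW jk) kn; have im := leq_trans (ltnW ij) jn.
have [ei pi qi] := q_par im; have [ej pj qj] := q_par jn; have [ek pk qk] := q_par kn.
have k0 : (0 < k)%N by exact: leq_ltn_trans jk.
have jk1 : (j <= k.-1)%N by rewrite -ltnS prednK.
have k1n : (k.-1 <= n)%N by exact: leq_trans (leq_pred k) kn.
have eij : e j = e i.
  by apply/eqP; rewrite eqn_leq {1}eik !e_mono // ltnW.
have [eki|eki] := eqVneq (e k) (e i).
  by rewrite qi qj qk eki eij /orient !mixE; ring.
have lt_ik : (e i < e k)%N.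
  by rewrite ltn_neqAle eq_sym eki e_mono // (leq_trans (ltnW ij) (ltnW jk)).
have rl : ((e i).+1 < l)%N by exact: leq_ltn_trans ek.
have [b [bn qb eb pb]] := vertex_index rl.
have kb : (k <= b)%N by rewrite -(prednK k0); apply: e_ltn => //; rewrite eb eik.
(* Gap [k.-1] lies on edge [e i] but [q k] has a later label, so [q k] is the end vertex of that
   edge. *)
have -> : q k = V (e i).+1.
  move: kb; rewrite leq_eqVlt => /predU1P[->//|kb].
  have [|[_]] := q_lt kb bn; first by rewrite eb ltnS leqNgt lt_ik.
  by rewrite pb ltNge; case/andP: pk => ->.
by rewrite qi qj eij orient_mix_edge orient_abb mulr0.
Qed.

Let orient_last_edge j k : (0 < j)%N -> (j < k)%N -> (k <= n)%N ->
  e j = e n -> orient (q 0%N) (q j) (q k) = 0.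
Proof.
move=> j0 jk kn ej; have jn := leq_trans (ltnW jk) kn.
have ek : e k = e n by apply/eqP; rewrite eqn_leq e_mono //= -ej e_mono // ltnW.
have [_ _ qj] := q_par jn; have [_ _ qk] := q_par kn.
rewrite q0E qj qk ej ek e_last prednK // -[V 0%N]V_period add0n.
by rewrite /orient !mixE; ring.
Qed.

Let first_last : (1 < n)%N /\ e 0 != e n.-1.
Proof.
have l1 : (1 < l)%N by exact: ltn_trans l_ge3.
have [b [bn _ eb _]] := vertex_index l1.
have [b0 [b0n _ eb0 _]] := vertex_index l_gt0.
have [b2 [b2n _ eb2 _]] := vertex_index l_ge3.
have h01 : (b0 < b)%N by apply: e_ltn => //; rewrite eb eb0.
have h12 : (b < b2)%N by apply: e_ltn => //; rewrite eb eb2.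
have bn1 : (b <= n.-1)%N by rewrite -ltnS prednK; lia.
split; first by lia.
have e0 : e 0 = 0%N.
  by have := e_mono (leq0n b0) b0n; rewrite eb0 leqn0 => /eqP.
by rewrite e0 eq_sym -lt0n -eb e_mono // leq_pred.
Qed.

(** The end vertex of edge [r] carries another label; this is the difference between the [(a r).+1]
    points of the edge and its [a r] gaps. *)
Let label_countE r : (r < l)%N -> label_count e r 0 n.+1 = a r.
Proof.
move=> rl; rewrite /label_count /n prednK //.
have -> : (\sum_(0 <= g < size s) (e g == r))%N = count (fun c => (key c).1 == r) s.
  rewrite -sum1_count [RHS]big_mkcond (big_nth (V 0)).
  by apply: eq_bigr => g _; rewrite /e /q; case: eqP.
rewrite /s count_sort.
apply: succn_inj; rewrite -V_count //.
pose A := [fset c in C | (key c).1 == r]%fset.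
have Vr1 : V r.+1 \notin A.
  rewrite !inE /= VC /=; apply/eqP => kr; have [_ /andP[_ k1]] := keyP (VC r.+1).
  have n1 : V r != V r.+1 by apply: (V_neq l_ge3 V_period V_inj) => //; lia.
  rewrite kr -{1}(mix1 (V r) (V r.+1)) => /(mix_inj n1) kk.
  by rewrite -kk ltxx in k1.
have -> : [fset c in C | c \in segment (V r) (V r.+1)]%fset = (V r.+1 |` A)%fset.
  apply/fsetP => c; rewrite in_fset1U /A !in_fset /= !inE; apply/andP/orP.
    move=> [cC /asboolP/segmentP[t /andP[t0 t1] ct]].
    have [t1'|t1'] := eqVneq t 1; first by left; rewrite ct t1' mix1.
    right; rewrite cC /=; have [i im ci] := (CE c).1 cC.
    have t01 : 0 <= t < 1 by rewrite t0 lt_neqAle t1' t1.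
    rewrite ci in ct *; have [ei _] := key_unique im rl t01 ct.
    by rewrite -[(key _).1]/(e i) ei.
  move=> [/eqP->|/andP[cC /eqP kc]]; split=> //.
  - by apply/asboolP/segmentP; exists 1; rewrite ?mix1 ?ler01 ?lexx.
  - have [_ /andP[k0 k1] ck] := keyP cC; apply/asboolP/segmentP.
    by exists (key c).2; rewrite ?k0 ?ltW // -kc.
rewrite cardfsU1 Vr1 add1n; congr S.
by rewrite -sum1_count card_fset_sum1 /A -big_fset_condE.
Qed.

Lemma tau_max_sorted :
  (tau_max C)%:Z = catalan_pairing (\prod_(i < l) max_edge_poly (a i)).
Proof.
have [n1 e0n] := first_last.
rewrite (@tau_max_labelled _ q e l n) //; last by move=> i /q_par[].
by congr catalan_pairing; apply: eq_bigr => r _; rewrite label_countE.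
Qed.

End SortedPolygon.

Theorem theorem2 (R : realType) (l : nat) (a : 'I_l -> nat)
    (C : {fset plane R}) (hl : (3 <= l)%N) (ha : forall i, (1 <= a i)%N)
    (hC : polygon_with_weights a C) :
  (tau_max C)%:Z = catalan_pairing (\prod_(i < l) max_edge_poly (a i)).
Proof.
have [wc [v [v_inj v_ext v_left v_count]]] := hC.
have l0 : (0 < l)%N by exact: ltn_trans hl.
(* Indices modulo [l] turn the cyclic successor into [.+1] and allow windows [i < j < k < i + l]. *)
pose o i : 'I_l := Ordinal (ltn_pmod i l0); pose V i := v (o i).
have oS i : o i.+1 = ordS (o i) by apply: val_inj; rewrite /= -addn1 -modnDml addn1.
have V_period i : V (i + l) = V i by congr v; apply: val_inj; rewrite /= modnDr.
have V_inj i j : (i < l)%N -> (j < l)%N -> V i = V j -> i = j.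
  by move=> il jl /v_inj /(congr1 val) /=; rewrite !modn_small.
have V_ext i : extremal_points (hull C) (V i) by rewrite -v_ext; exists (o i).
have V_left i c : c \in C -> 0 <= orient (V i) (V i.+1) c.
  by rewrite /V oS; apply: v_left.
have ov (i : 'I_l) : o i = i by apply: val_inj; rewrite /= modn_small.
have V_count i : (i < l)%N ->
    #|` [fset c in C | c \in segment (V i) (V i.+1)]%fset| = (a (o i)).+1.
  by move=> _; rewrite /V oS; apply: v_count.
have [key keyP] : {key & forall c, c \in C -> [/\ ((key c).1 < l)%N, 0 <= (key c).2 < 1 &
    c = mix (key c).2 (V (key c).1) (V (key c).1.+1)]}.
  apply: (@choice _ (nat * R)%type (fun c k => c \in C -> [/\ (k.1 < l)%N, 0 <= k.2 < 1 &
    c = mix k.2 (V k.1) (V k.1.+1)])) => c.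
  have [cC|nC] := boolP (c \in C); last by exists (0%N, 0).
  have [i [t h]] := edge_param hl V_period V_inj V_ext V_left cC (wc c cC).
  by exists (i, t).
rewrite (tau_max_sorted (a := fun i => a (o i)) hl V_period V_inj V_ext V_left V_count keyP).
by congr catalan_pairing; apply: eq_bigr => i _; rewrite ov.
Qed.
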